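(* Fix $y\in\mathbb{R}$. For each $N$ let $\mathcal{D}_{\mathrm{obs}}=(X_i)_{1\le i\le n_N}$ be $n_N$ i.i.d. observational samples and $\mathcal{D}_{\mathrm{int}}=(Y_i)_{1\le i\le m_N}$ be $m_N$ i.i.d. interventional samples under $do(Y(2)=y)$, independent of the observational ones, with $n_N+m_N=N$, $n_N$ and $m_N$ increasing in $N$, and $n_N/N\to\eta\in(0,1)$. Let $\mathcal{D}_{\mathrm{mix}}=\mathcal{D}_{\mathrm{obs}}\cup\mathcal{D}_{\mathrm{int}}$. Assume that the prior densities $\pi(\theta\mid S)$ are four times differentiable for every $S\in\{S^1,S^2,S^3\}$. If the true generating model is $(S^3,\theta^* )$ with $\theta^*=(0,\tau_1^{*2},\tau_2^{*2})$, $\tau_1^{*2},\tau_2^{*2}>0$, then as $N\to\infty$ $$\sqrt{N}\,\bigl(1-\pi(S^3\mid\mathcal{D}_{\mathrm{mix}})\bigr)=O_p(1),$$ where $O_p(1)$ means bounded in probability.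
   Context: Models. Let $\Theta=\mathbb{R}\times(0,\infty)^2$ with elements $\theta=(w,\tau_1^2,\tau_2^2)$. Let $\epsilon=(\epsilon(1),\epsilon(2))$ be centered Gaussian with covariance $\mathrm{Diag}(\tau_1^2,\tau_2^2)$. For each structure $S$ and parameter $\theta$, an observational sample $X=(X(1),X(2))\in\mathbb{R}^2$ is distributed as follows: - $S^1$: $X(2)=\epsilon(2)$, $X(1)=wX(2)+\epsilon(1)$ (edge $X(2)\to X(1)$); - $S^2$: $X(1)=\epsilon(1)$, $X(2)=wX(1)+\epsilon(2)$ (edge $X(1)\to X(2)$); - $S^3$: $X(1)=\epsilon(1)$, $X(2)=\epsilon(2)$ (independence model; $w$ is fixed to $0$ and the only free parameters are $(\tau_1^2,\tau_2^2)\in(0,\infty)^2$). Interventional samples under $do(Y(2)=y)$ are $Y=(Y(1),y)$, where $Y(1)\sim N(wy,\tau_1^2)$ under $S^1$, and $Y(1)\sim N(0,\tau_1^2)$ under $S^2$ and under $S^3$. Likelihood. $f(\mathcal{D}_{\mathrm{mix}}\mid S,\theta)$ is the product of the Lebesgue densities of the $X_i$ and of the densities of the $Y_j(1)$ under $(S,\theta)$. Prior and posterior. The prior on structures is uniform, $\pi(S^j)=1/3$. Given $S$, the parameter has a prior probability density $\pi(\theta\mid S)$ on its parameter space ($\Theta$ for $S^1,S^2$; for $S^3$ a density on $(\tau_1^2,\tau_2^2)\in(0,\infty)^2$). Then $$\pi(S\mid\mathcal{D}_{\mathrm{mix}})=\frac{\int f(\mathcal{D}_{\mathrm{mix}}\mid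 S,\theta)\pi(\theta\mid S)\,d\theta}{\sum_{j=1}^3\int f(\mathcal{D}_{\mathrm{mix}}\mid S^j,\theta)\pi(\theta\mid S^j)\,d\theta},$$ each integral being over the parameter space of the corresponding structure.
   Formalization: The formal theorem additionally assumes that the prior density of S^3 is strictly positive at the true variances; without this the claim fails, e.g. when that prior vanishes near the truth while the prior of S^1 is positive there. *)

(* Defs.v *)
From HB Require Import structures.
From mathcomp Require Import all_boot all_order all_algebra.
From mathcomp Require Import all_classical all_reals all_analysis.

Set Implicit Arguments.
Unset Strict Implicit.
Unset Printing Implicit Defensive.

Import Order.TTheory GRing.Theory Num.Theory.
Import numFieldNormedType.Exports.

Local Open Scope classical_set_scope.
Local Open Scope ring_scope.

(* f is k times (Frechet) differentiable at every point of the open set D.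
   V is meant to be finite-dimensional, so that the differential
   x |-> 'd f x, with values in the linear forms on V, is k times
   differentiable iff each of its evaluations x |-> 'd f x v is. *)
Fixpoint ndifferentiable (R : realType) (V : normedModType R) (k : nat)
    (D : set V) (f : V -> R) : Prop :=
  if k is k'.+1 then
    (forall x, D x -> differentiable f x) /\
    (forall v, ndifferentiable k' D (fun x => 'd f x v))
  else True.

Definition is_density d (T : measurableType d) (R : realType)
    (mu : set T -> \bar R) (D : set T) (f : T -> R) : Prop :=
  [/\ measurable_fun D f, forall x, D x -> 0 <= f x
    & (\int[mu]_(x in D) (f x)%:E = 1)%E].

Definition mutually_independent d d' (T : measurableType d)
    (T' : measurableType d') (R : realType) (P : probability T R)
    (I : finType) (X : I -> {RV P >-> T'}) : Prop :=
  forall (J : {set I}) (A : I -> set T'), (forall i, measurable (A i)) ->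
    P [set o | forall i, i \in J -> A i (X i o)] =
    (\prod_(i in J) P (X i @^-1` A i))%E.

Definition bounded_in_probability d (T : measurableType d) (R : realType)
    (P : probability T R) (Z : nat -> T -> R) : Prop :=
  forall e : R, 0 < e -> exists M : R,
    \forall N \near \oo, (P [set o | (M < `|Z N o|)%R] <= e%:E)%E.

Inductive structure := S1 | S2 | S3.

(* A parameter is (w, (t1, t2)), where t1 and t2 are the noise *variances*
   tau_1^2 and tau_2^2; [normal_prob m s] and [normal_pdf m s] take the
   standard deviation s. *)
Definition variances (R : realType) : set (R * R) :=
  [set t | 0 < t.1 /\ 0 < t.2].

Definition Theta (R : realType) : set (R * (R * R)) :=
  [set th | variances th.2].

(* X as a function of the noise (epsilon(1), epsilon(2)). *)
Definition sem (R : realType) (S : structure) (w : R) (e : R * R) : R * R :=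
  match S with
  | S1 => (w * e.2 + e.1, e.2)
  | S2 => (e.1, w * e.1 + e.2)
  | S3 => e
  end.

Definition noise_law (R : realType) (t : R * R) :
    set (measurableTypeR R * measurableTypeR R) -> \bar R :=
  (normal_prob 0 (Num.sqrt t.1) \x normal_prob 0 (Num.sqrt t.2))%E.

Definition obs_law (R : realType) (S : structure) (th : R * (R * R)) :
    set (R * R) -> \bar R :=
  pushforward (noise_law th.2) (sem S th.1).

(* Mean of Y(1) under do(Y(2) = y). *)
Definition do_mean (R : realType) (S : structure) (w y : R) : R :=
  if S is S1 then w * y else 0.

Definition int_law (R : realType) (y : R) (S : structure)
    (th : R * (R * R)) : set (R * R) -> \bar R :=
  pushforward (normal_prob (do_mean S th.1 y) (Num.sqrt th.2.1))
    (fun u => (u, y)).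

(* Density of obs_law S th with respect to the Lebesgue measure on R^2. *)
Definition obs_pdf (R : realType) (S : structure) (th : R * (R * R))
    (x : R * R) : R :=
  let: (w, (t1, t2)) := th in
  match S with
  | S1 => normal_pdf 0 (Num.sqrt t2) x.2 *
          normal_pdf (w * x.2) (Num.sqrt t1) x.1
  | S2 => normal_pdf 0 (Num.sqrt t1) x.1 *
          normal_pdf (w * x.1) (Num.sqrt t2) x.2
  | S3 => normal_pdf 0 (Num.sqrt t1) x.1 * normal_pdf 0 (Num.sqrt t2) x.2
  end.

Definition int_pdf (R : realType) (y : R) (S : structure)
    (th : R * (R * R)) (u : R) : R :=
  normal_pdf (do_mean S th.1 y) (Num.sqrt th.2.1) u.

Definition likelihood (R : realType) (y : R) (n m : nat)
    (xs : 'I_n -> R * R) (ys : 'I_m -> R * R)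
    (S : structure) (th : R * (R * R)) : R :=
  (\prod_(i < n) obs_pdf S th (xs i)) * \prod_(j < m) int_pdf y S th (ys j).1.

Record priors (R : realType) := Priors {
  prior1 : R * (R * R) -> R;
  prior2 : R * (R * R) -> R;
  prior3 : R * R -> R
}.

Definition leb2 (R : realType) :
    set (measurableTypeR R * measurableTypeR R) -> \bar R :=
  (@lebesgue_measure R \x @lebesgue_measure R)%E.

HB.instance Definition _ (R : realType) := Measure.on (@leb2 R).

Lemma leb2_sigma_finite (R : realType) : sigma_finite setT (@leb2 R).
Proof.
have /sigma_finiteP[F [TF ndF Foo]] := sigma_finiteT (@lebesgue_measure R).
exists (fun n => F n `*` F n).
  rewrite -setXTT TF predeqE => -[x y]; split.
    move=> [/= [n _ Fnx] [k _ Fky]]; exists (maxn n k) => //; split.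
    - by move: x Fnx; exact/subsetPset/ndF/leq_maxl.
    - by move: y Fky; exact/subsetPset/ndF/leq_maxr.
  by move=> [n _ []/= ? ?]; split; exists n.
move=> k; have [? ?] := Foo k; split; first exact: measurableX.
by rewrite /leb2 product_measure1E// lte_mul_pinfty// ge0_fin_numE.
Qed.

HB.instance Definition _ (R : realType) :=
  Measure_isSigmaFinite.Build _ _ _ (@leb2 R) (@leb2_sigma_finite R).

Definition leb3 (R : realType) :
    set (measurableTypeR R * (measurableTypeR R * measurableTypeR R)) -> \bar R :=
  (@lebesgue_measure R \x @leb2 R)%E.

HB.instance Definition _ (R : realType) := Measure.on (@leb3 R).

Definition evidence (R : realType) (pi : priors R) (y : R) (n m : nat)
    (xs : 'I_n -> R * R) (ys : 'I_m -> R * R) (S : structure) : \bar R :=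
  match S with
  | S1 => (\int[@leb3 R]_(th in @Theta R)
             (likelihood y xs ys S1 th * prior1 pi th)%:E)%E
  | S2 => (\int[@leb3 R]_(th in @Theta R)
             (likelihood y xs ys S2 th * prior2 pi th)%:E)%E
  | S3 => (\int[@leb2 R]_(t in @variances R)
             (likelihood y xs ys S3 (0, t) * prior3 pi t)%:E)%E
  end.

(* The uniform prior 1/3 on structures cancels. An evidence can be infinite
   only for very small sample sizes or degenerate samples; fine then returns 0,
   which is irrelevant as N goes to infinity. *)
Definition posterior (R : realType) (pi : priors R) (y : R) (n m : nat)
    (xs : 'I_n -> R * R) (ys : 'I_m -> R * R) (S : structure) : R :=
  let ev S := fine (evidence pi y xs ys S) in
  ev S / (ev S1 + ev S2 + ev S3).

(* Main.v *)
Require Import Defs.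
From HB Require Import structures.
From mathcomp Require Import all_boot all_order all_algebra.
From mathcomp Require Import all_classical all_reals all_analysis.
From mathcomp Require Import measurable_realfun ring lra.

(** Why the theorem holds.  The independence structure S3 is S1, and also S2,
    with the slope w put to 0.  For all three structures the likelihood at
    variances t is, up to one common factor, exp (- (d1 + d2) / 2), where
    [deviance p k t = p ln t + k / t] is evaluated at a residual sum of squares
    ([likelihoodE]).  A free slope replaces one of the two sums of squares, say
    C, by the quadratic C - 2 w B + w^2 A, where A is of the order of the sample
    size N.  Under S3 the cross term B is a sum of centred pairwise uncorrelated
    terms, hence of order sqrt N, and completing the square shows that the slope
    gains at most a bounded amount on C and loses a multiple of N w^2.

    So at parameters near the truth the likelihood of S1 or S2 is at most
    a constant times exp (- b N w^2) times the likelihood of S3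
    ([gauss_lik_near]).  There the priors of S1 and S2 are bounded and the prior
    of S3 is bounded below, by continuity and because it is positive at the
    truth; integrating the Gaussian factor over w makes the evidence of S1 or S2
    at most a constant times 1 / sqrt N times the evidence of S3.  The integrals
    over the variances are the same on both sides and cancel.

    Away from the truth the prior of S1 or S2 may be unbounded, but its total
    mass is 1, and the likelihood is exponentially smaller than on a fixed small
    rectangle touching the truth ([gauss_lik_far], [gauss_lik_peak_le]): as a
    function of t, the deviance has its minimum where t is the mean square
    k / p, and it grows by a multiple of p when t leaves a neighbourhood of it,
    or when k / p is increased by a slope bounded away from 0.  This part is
    absorbed by 1 / sqrt N.  [evidence_le] puts the two regions together, and
    [gauss_lik_evidence_ratio] chooses the constants.

    The event on which all this applies fixes five empirical means: the mean
    squares of both observed coordinates and of the intervened one are close to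
    the true variances, and the two sums that make up B are at most kap sqrt N
    ([posterior_bound]).  By Chebyshev's inequality
    ([chebyshev_pairwise_independent]), which requires the first, second and
    fourth Gaussian moments, the first three have probability tending to 1, and
    the other two have probability close to 1 once kap is large.  Boundedness in
    probability is a statement on the measure of a set defined by the
    posterior, so the posterior must be a measurable function of the sample
    ([measurable_posterior]); this is Tonelli's theorem. *)

Set Implicit Arguments.
Unset Strict Implicit.
Unset Printing Implicit Defensive.

Import Order.TTheory GRing.Theory Num.Theory.
Import numFieldNormedType.Exports HBNNSimple.

Local Open Scope classical_set_scope.
Local Open Scope ring_scope.

(** * Gaussian moments *)

(** Both sides are continuous along increasing sequences of functions and
    additive, so the identity assumed on sets extends through simple
    functions. *)
Lemma ge0_integral_density d (T : measurableType d) (R : realType)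
    (mu nu : {measure set T -> \bar R}) (g : T -> R) (f : T -> \bar R) :
  measurable_fun setT g -> (forall x, 0 <= g x) ->
  (forall A, measurable A -> nu A = \int[mu]_(x in A) (g x)%:E)%E ->
  measurable_fun setT f -> (forall x, 0 <= f x)%E ->
  (\int[nu]_x f x = \int[mu]_x (f x * (g x)%:E))%E.
Proof.
move=> mg g0 nuE mf f0.
pose f_ := nnsfun_approx measurableT mf.
transitivity (limn (fun n => \int[nu]_x (f_ n x)%:E))%E.
  rewrite -monotone_convergence//.
  - apply: eq_integral => x _; apply/esym/cvg_lim => //.
    exact: cvg_nnsfun_approx.
  - by move=> n; exact/measurable_EFinP/measurable_funP.
  - by move=> n x _; rewrite lee_fin; exact: fun_ge0.
  - by move=> x _ m n mn; rewrite lee_fin; exact/lefP/nd_nnsfun_approx.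
transitivity (limn (fun n => \int[mu]_x ((f_ n x)%:E * (g x)%:E)))%E; last first.
  rewrite -monotone_convergence//.
  - apply: eq_integral => x _; apply/cvg_lim => //.
    apply: cvgeZr => //.
    exact: cvg_nnsfun_approx.
  - move=> n; apply: emeasurable_funM; apply/measurable_EFinP => //.
  - move=> n x _; rewrite mule_ge0// lee_fin//.
  - move=> x _ m n mn; rewrite lee_wpmul2r ?lee_fin//.
    exact/lefP/nd_nnsfun_approx.
congr (limn _); apply/funext => n.
under eq_integral do rewrite fimfunE -fsumEFin//.
under [RHS]eq_integral do rewrite fimfunE.
rewrite ge0_integral_fsum//; last 2 first.
  - by move=> y; exact/measurable_EFinP/measurable_funM.
  - by move=> y x _; rewrite nnfun_muleindic_ge0.
rewrite (eq_integral (fun x => \sum_(r \in range (f_ n))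
   ((r * \1_(f_ n @^-1` [set r]) x)%:E * (g x)%:E))%E); last first.
  move=> x _; rewrite -fsumEFin// ge0_mule_fsuml// => r.
  exact: nnfun_muleindic_ge0.
rewrite ge0_integral_fsum//; last 2 first.
  - by move=> y; apply: emeasurable_funM => //; apply/measurable_EFinP => //;
     exact: measurable_funM.
  - by move=> y x _; rewrite mule_ge0// ?lee_fin// -lee_fin nnfun_muleindic_ge0.
apply: eq_fsbigr => r _.
have [r0|r0] := leP 0 r; last first.
  rewrite (preimage_nnfun0 _ r0); under eq_integral do rewrite indic0 mulr0.
  by under [RHS]eq_integral do rewrite indic0 mulr0 mul0e; rewrite !integral0.
under eq_integral do rewrite EFinM.
under [RHS]eq_integral do rewrite EFinM -muleA.
rewrite !ge0_integralZl//.
- congr (_ * _)%E; rewrite integral_indic// setIT nuE// integral_mkcond.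
  apply: eq_integral => x _ /=; rewrite patchE indicE.
  by case: ifP => _; rewrite ?mul1e ?mul0e.
- by apply: emeasurable_funM => //; apply/measurable_EFinP.
- by move=> x _; rewrite mule_ge0// lee_fin.
- exact/measurable_EFinP.
Qed.

Section gaussian_moments.
Context {R : realType} (s : R) (s0 : 0 < s).
Local Notation mu := (@lebesgue_measure R).

Let h (x : R) : R := expR (- x ^+ 2 / (s ^+ 2 *+ 2)).
Let F (x : R) : R := x * h x.
Let f (x : R) : R := (1 - x ^+ 2 / s ^+ 2) * h x.

Let dF (x : R) : is_derive x 1 F (f x).
Proof.
rewrite /F /h; apply: is_derive_eq.
rewrite /f /h /GRing.scale/=; by field; rewrite ?gt_eqF.
Qed.

Let dNF (x : R) : is_derive x 1 (fun x => - F x) (- f x).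
Proof. by have := dF x => dFx; apply: is_derive_eq. Qed.

Let cF : continuous F.
Proof. by move=> x; apply: differentiable_continuous; apply/derivable1_diffP; case: (dF x). Qed.

Let ch : continuous h.
Proof.
move=> x; apply/differentiable_continuous/derivable1_diffP.
by apply: ex_derive.
Qed.

Let cf : continuous f.
Proof.
move=> x; apply/differentiable_continuous/derivable1_diffP.
by rewrite /f /h; apply: ex_derive.
Qed.

Let cNf : continuous (fun x => - f x).
Proof. by move=> x; apply: continuousN; exact: cf. Qed.

Let cg : continuous (fun x : R => x ^+ 2 / s ^+ 2 * h x).
Proof.
move=> x; apply/differentiable_continuous/derivable1_diffP.
by rewrite /h; apply: ex_derive.
Qed.

Let mh : measurable_fun [set: R] h.
Proof. exact: continuous_measurable_fun. Qed.

Let mf : measurable_fun [set: R] f.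
Proof. exact: continuous_measurable_fun. Qed.

Let mNf : measurable_fun [set: R] (fun x => - f x).
Proof. exact: measurableT_comp. Qed.

Let mg : measurable_fun [set: R] (fun x : R => x ^+ 2 / s ^+ 2 * h x).
Proof. exact: continuous_measurable_fun. Qed.

Let F_cvg0 : F x @[x --> +oo%R] --> (0 : R).
Proof.
have s20 : 0 < s ^+ 2 *+ 2 by rewrite pmulrn_lgt0// exprn_gt0.
apply: (@squeeze_cvgr _ _ _ _ (cst 0) (fun x : R => (s ^+ 2 *+ 2) * x^-1)).
- near=> x.
  have x0 : 0 < x by near: x; exact: nbhs_pinfty_gt.
  apply/andP; split; first by rewrite mulr_ge0 ?expR_ge0// ltW.
  rewrite /F /h mulNr expRN ler_pdivrMr ?expR_gt0//.
  have := expR_ge1Dx (x ^+ 2 / (s ^+ 2 *+ 2)).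
  set E := expR _ => H.
  rewrite mulrAC ler_pdivlMr// -expr2 -ler_pdivrMl//.
  by rewrite mulrC (le_trans _ H)// lerDr.
- exact: cvg_cst.
- rewrite -[X in _ --> X](mulr0 (s ^+ 2 *+ 2)).
  apply: cvgM; first exact: cvg_cst.
  apply/(@gtr0_cvgV0 _ _ _ _ (fun x : R => x)); last exact: cvg_id.
  by near=> x; near: x; exact: nbhs_pinfty_gt.
Unshelve. all: by end_near. Qed.

Let int_head : (\int[mu]_(x in `[0%R, s]) (h x)%:E =
  \int[mu]_(x in `[0%R, s]) (x ^+ 2 / s ^+ 2 * h x)%R%:E + (F s)%:E)%E.
Proof.
have <- : (\int[mu]_(x in `[0%R, s]) (f x)%:E = (F s)%:E)%E.
  rewrite (@continuous_FTC2 _ f F)//.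
  - by rewrite /F mul0r sube0.
  - exact: continuous_subspaceT.
  - split; first by move=> x _; case: (dF x).
    + by apply: cvg_at_right_filter; exact: cF.
    + by apply: cvg_at_left_filter; exact: cF.
  - by move=> x _; rewrite derive1E; case: (dF x).
rewrite -ge0_integralD//=.
- by apply: eq_integral => x _; rewrite -EFinD /f; congr EFin; lra.
- by move=> x _; rewrite lee_fin mulr_ge0 ?expR_ge0// divr_ge0// sqr_ge0.
- apply/measurable_EFinP/measurable_funTS; exact: mg.
- move=> x; rewrite in_itv/= => /andP[x0 xs].
  rewrite lee_fin mulr_ge0 ?expR_ge0// subr_ge0 ler_pdivrMr ?exprn_gt0// mul1r.
  by rewrite ler_pXn2r// nnegrE ltW.
- apply/measurable_EFinP/measurable_funTS; exact: mf.
Qed.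

Let int_tail : (\int[mu]_(x in `]s, +oo[) (x ^+ 2 / s ^+ 2 * h x)%R%:E =
  \int[mu]_(x in `]s, +oo[) (h x)%:E + (F s)%:E)%E.
Proof.
have <- : (\int[mu]_(x in `]s, +oo[) (- f x)%R%:E = (F s)%:E)%E.
  rewrite integral_itv_obnd_cbnd; last first.
    apply/measurable_EFinP/measurable_funTS; exact: mNf.
  rewrite (@ge0_continuous_FTC2y R (fun x : R => (- f x)%R) (fun x : R => (- F x)%R) s 0%R)//.
  - by rewrite sub0e -EFinN opprK.
  - move=> x sx; rewrite /f -mulNr mulr_ge0 ?expR_ge0//.
    rewrite opprB subr_ge0 ler_pdivlMr ?exprn_gt0// mul1r.
    by rewrite ler_pXn2r ?nnegrE// ltW// (lt_le_trans s0).
  - by apply: continuous_subspaceT ; exact: cNf.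
  - by rewrite -[X in _ --> X]oppr0; exact: cvgN F_cvg0.
  - by apply: cvgN; apply: cvg_at_right_filter; exact: cF.
  - by move=> x _; rewrite derive1E; case: (dNF x).
rewrite -ge0_integralD//=.
- by apply: eq_integral => x _; rewrite -EFinD /f; congr EFin; lra.
- by move=> x _; rewrite lee_fin expR_ge0.
- apply/measurable_EFinP/measurable_funTS; exact: mh.
- move=> x; rewrite in_itv/= andbT => sx.
  rewrite lee_fin /f -mulNr mulr_ge0 ?expR_ge0//.
  rewrite opprB subr_ge0 ler_pdivlMr ?exprn_gt0// mul1r.
  by rewrite ler_pXn2r ?nnegrE// ltW// (lt_trans s0).
- apply/measurable_EFinP/measurable_funTS; exact: mNf.
Qed.

(** With h the Gaussian function of deviation s, the derivative of x h(x) is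
    (1 - x^2 / s^2) h(x), which has a constant sign on each side of s.  Hence the
    fundamental theorem of calculus applies separately to [0, s] and to
    [s, +oo[: on the first interval the integral of h exceeds that of
    (x / s)^2 h by s h(s), on the second it falls short by the same amount. *)
Lemma gaussian_second_moment :
  (\int[mu]_x (x ^+ 2 / s ^+ 2 * h x)%R%:E = \int[mu]_x (h x)%:E)%E.
Proof.
have half (k : R -> R) : measurable_fun setT k -> (forall x, 0 <= k x) ->
    (\int[mu]_(x in [set x | (0 <= x)%R]) (k x)%:E =
     \int[mu]_(x in `[0%R, s]) (k x)%:E + \int[mu]_(x in `]s, +oo[) (k x)%:E)%E.
  move=> mk k0; rewrite -set_itvcy -ge0_integral_setU//=.
  - congr integral; apply/seteqP; split => x /=; rewrite !in_itv/= ?andbT.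
    + by move=> x0; case: (leP x s) => xs; [left; rewrite x0|right].
    + by move=> [/andP[]//|sx]; rewrite ltW// (lt_trans s0).
  - exact/measurable_EFinP/measurable_funTS.
  - by move=> x _; rewrite lee_fin.
  - apply/disj_setPS => x /=; rewrite !in_itv/= andbT => -[/andP[_ xs] sx].
    by move: (le_lt_trans xs sx); rewrite ltxx.
have g0 (x : R) : 0 <= x ^+ 2 / s ^+ 2 * h x.
  by rewrite mulr_ge0 ?expR_ge0// divr_ge0// sqr_ge0.
have h0 (x : R) : 0 <= h x by exact: expR_ge0.
have hN : h =1 h \o -%R by move=> x; rewrite /h/= sqrrN.
rewrite (ge0_symfun_integralT h0 ch hN) (ge0_symfun_integralT g0 cg); last first.
  by move=> x; rewrite /= sqrrN; congr (_ * _); exact: hN.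
rewrite (half _ mg g0) (half _ mh h0).
congr (_ * _)%E; rewrite int_head int_tail.
by rewrite -addeA (addeC (F s)%:E).
Qed.

End gaussian_moments.

Section normal_moments.
Context {R : realType} (s : R) (s0 : 0 < s).
Local Notation mu := (@lebesgue_measure R).
Local Notation nu := (normal_prob 0 s).

Lemma ge0_integral_normal_prob (f : R -> \bar R) :
  measurable_fun [set: R] f -> (forall x, 0 <= f x)%E ->
  (\int[nu]_x f x = \int[mu]_x (f x * (normal_pdf 0 s x)%:E))%E.
Proof.
move=> mf f0.
apply: (@ge0_integral_density _ _ _ mu nu (normal_pdf 0 s)) => //.
- exact: measurable_normal_pdf.
- exact: normal_pdf_ge0.
Qed.

Lemma normal_second_moment : (\int[nu]_x (x ^+ 2)%:E = (s ^+ 2)%:E)%E.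
Proof.
have sn0 : s != 0 by rewrite gt_eqF.
rewrite ge0_integral_normal_prob; last 2 first.
- by apply/measurable_EFinP; exact: measurable_funX.
- by move=> x; rewrite lee_fin sqr_ge0.
under eq_integral => x _.
  rewrite -EFinM normal_pdfE// /normal_fun subr0.
  rewrite (_ : _ * _ = (s ^+ 2 * normal_peak s) * (x ^+ 2 / s ^+ 2 * expR (- x ^+ 2 / (s ^+ 2 *+ 2)))); last by field.
  rewrite EFinM; over.
have mh : measurable_fun [set: R] (fun x : R => expR (- x ^+ 2 / (s ^+ 2 *+ 2))).
  by have := measurable_normal_fun 0 s; rewrite /normal_fun; under eq_fun do rewrite subr0.
have hE (x : R) : normal_pdf 0 s x = normal_peak s * expR (- x ^+ 2 / (s ^+ 2 *+ 2)).
  by rewrite normal_pdfE// /normal_fun subr0.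
have mhE : measurable_fun [set: R] (fun x : R => (expR (- x ^+ 2 / (s ^+ 2 *+ 2)))%:E).
  exact/measurable_EFinP.
rewrite (ge0_integralZl_EFin mu measurableT _ _ (mulr_ge0 (sqr_ge0 _) (normal_peak_ge0 s))).
- rewrite gaussian_second_moment// EFinM -muleA.
  rewrite -(ge0_integralZl_EFin mu measurableT _ mhE (normal_peak_ge0 s)).
    rewrite -[RHS]mule1 -(integral_normal_pdf 0 s); congr (_ * _)%E.
    by apply: eq_integral => x _; rewrite -EFinM hE.
  by move=> x _; rewrite lee_fin expR_ge0.
- by move=> x _; rewrite lee_fin mulr_ge0 ?expR_ge0// divr_ge0// sqr_ge0.
- apply/measurable_EFinP; apply: measurable_funM => //.
  by apply: measurable_funM => //; exact: measurable_funX.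
Qed.

Lemma normal_fourth_moment_lty : (\int[nu]_x (x ^+ 4)%:E < +oo)%E.
Proof.
have sn0 : s != 0 by rewrite gt_eqF.
(* The power is absorbed by one half of the exponent: with u = x^2 / (4 s^2),
   (u / 2)^2 <= exp u and x^4 = 64 s^4 (u / 2)^2.  The remaining factor exp (- u)
   is a Gaussian function of deviation sqrt 2 * s. *)
pose s' := Num.sqrt 2 * s.
have s'0 : s' != 0 by rewrite mulf_neq0// gt_eqF// sqrtr_gt0.
have p0 := normal_peak_gt0 s'0.
rewrite ge0_integral_normal_prob; last 2 first.
- by apply/measurable_EFinP; exact: measurable_funX.
- by move=> x; rewrite lee_fin exprn_even_ge0.
pose K := 64 * s ^+ 4 * normal_peak s / normal_peak s'.
have K0 : 0 <= K by rewrite divr_ge0 ?normal_peak_ge0// mulr_ge0 ?normal_peak_ge0// mulr_ge0 ?exprn_ge0// ltW.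
apply: (@le_lt_trans _ _ (\int[mu]_x (K%:E * (normal_pdf 0 s' x)%:E))%E).
  apply: ge0_le_integral => //.
  - by move=> x _; rewrite lee_fin mulr_ge0 ?normal_pdf_ge0// exprn_even_ge0.
  - apply/measurable_EFinP/measurable_funM; first exact: measurable_funX.
    exact: measurable_normal_pdf.
  - apply/measurable_EFinP/measurable_funM => //.
    exact: measurable_normal_pdf.
  move=> x _; rewrite -EFinM lee_fin !normal_pdfE// /normal_fun !subr0.
  set E' := expR (_ / (s' ^+ 2 *+ 2)).
  have -> : K * (normal_peak s' * E') = normal_peak s * (64 * s ^+ 4 * E').
    by rewrite /K; field; rewrite gt_eqF.
  rewrite mulrCA /E' /s'.
  rewrite ler_wpM2l ?normal_peak_ge0//.
  rewrite [in leRHS]exprMn sqr_sqrtr//.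
  set u := x ^+ 2 / (s ^+ 2 *+ 4).
  have -> : - x ^+ 2 / (s ^+ 2 *+ 2) = - u - u by rewrite /u; field.
  have -> : - x ^+ 2 / ((2 * s ^+ 2) *+ 2) = - u by rewrite /u; field.
  have -> : x ^+ 4 = 64 * s ^+ 4 * (u / 2) ^+ 2 by rewrite /u; field.
  rewrite expRD mulrA ler_wpM2r ?expR_ge0// -[leLHS]mulrA ler_piMr//.
    by rewrite mulr_ge0// exprn_ge0// ltW.
  have u0 : 0 <= u by rewrite divr_ge0 ?sqr_ge0// mulrn_wge0// sqr_ge0.
  rewrite expRN ler_pdivrMr ?expR_gt0// mul1r.
  have -> : expR u = expR (u / 2) ^+ 2 by rewrite -expRM_natr mulfVK.
  rewrite ler_pXn2r ?nnegrE ?expR_ge0//; last by rewrite divr_ge0.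
  rewrite (le_trans _ (expR_ge1Dx _))// lerDr//.
rewrite ge0_integralZl_EFin//.
- by rewrite integral_normal_pdf mule1 ltry.
- by move=> x _; rewrite lee_fin normal_pdf_ge0.
- by apply/measurable_EFinP; exact: measurable_normal_pdf.
Qed.

(** The positive and the negative part have the same integral by symmetry, and
    this integral is finite by comparison with 1 + x^2. *)
Lemma normal_mean : (\int[nu]_x x%:E = 0)%E.
Proof.
pose p (x : R) : R := Num.max x 0.
have mp : measurable_fun [set: R] p by exact: measurable_maxr.
have p0 x : 0 <= p x by rewrite le_max lexx orbT.
have -> : (\int[nu]_x x%:E = \int[nu]_x (p x)%:E - \int[nu]_x (p (- x))%:E)%E.
  rewrite integralE; congr (_ - _)%E; apply: eq_integral => x _ /=.
    by rewrite funeposE /p EFin_max.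
  by rewrite funenegE /p EFin_max.
have mpN : measurable_fun [set: R] (fun x => p (- x)) by exact: measurableT_comp.
have symm (f : R -> R) : measurable_fun [set: R] f -> (forall x, 0 <= f x) ->
   (\int[mu]_x (f (- x)%R)%:E = \int[mu]_x (f x)%:E)%E.
  move=> mf f0.
  have := @ge0_integral_pushforward _ _ _ _ R (-%R : measurableTypeR R -> measurableTypeR R) _ mu setT (fun x => (f x)%:E).
  rewrite preimage_setT => <-//; last 2 first.
  - exact/measurable_EFinP.
  - by move=> x _; rewrite lee_fin.
  by apply: eq_measure_integral => //= A mA _; exact: lebesgue_measureN.
have fin : (\int[nu]_x (p x)%:E < +oo)%E.
  apply: (@le_lt_trans _ _ (\int[nu]_x (1 + (x ^+ 2)%:E)))%E.
    apply: ge0_le_integral => //.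
    - by move=> x _; rewrite lee_fin.
    - exact/measurable_EFinP.
    - by apply/measurable_EFinP/measurable_funD => //; exact: measurable_funX.
    - move=> x _; rewrite -EFinD lee_fin /p ge_max; apply/andP; split; last first.
        by rewrite addr_ge0// sqr_ge0.
      by nra.
  rewrite ge0_integralD//=; last 2 first.
  - by move=> x _; rewrite lee_fin sqr_ge0.
  - by apply/measurable_EFinP; exact: measurable_funX.
  rewrite normal_second_moment integral_cst//= mul1e probability_setT.
  by rewrite -EFinD ltry.
have -> : (\int[nu]_x (p (- x)%R)%:E = \int[nu]_x (p x)%:E)%E.
  rewrite !ge0_integral_normal_prob//; try by move=> x; rewrite lee_fin.
  - rewrite -(symm (fun x => p x * normal_pdf 0 s x)).
    + apply: eq_integral => x _; rewrite -EFinM; congr (_ * _)%:E.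
      by rewrite !normal_pdfE ?gt_eqF// /normal_fun !subr0 sqrrN.
    + by apply: measurable_funM => //; exact: measurable_normal_pdf.
    + by move=> x; rewrite mulr_ge0// normal_pdf_ge0.
  - exact/measurable_EFinP.
  - exact/measurable_EFinP.
rewrite subee// ge0_fin_numE//.
by apply: integral_ge0 => x _; rewrite lee_fin.
Qed.

End normal_moments.

(** * Weak law for pairwise independent samples *)

Section pairwise_independence.
Context d (T : measurableType d) (R : realType) (P : probability T R).

Lemma integrable_of_sqr (f : T -> R) : measurable_fun setT f ->
  (\int[P]_x (f x ^+ 2)%:E < +oo)%E -> P.-integrable setT (EFin \o f).
Proof.
move=> mf f2; apply/integrableP; split; first exact/measurable_EFinP.
apply: (@le_lt_trans _ _ (\int[P]_x (1 + (f x ^+ 2)%:E)))%E.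
  apply: ge0_le_integral => //.
  - by do 2 apply: measurableT_comp => //.
  - apply/measurable_EFinP/measurable_funD => //; exact: measurable_funX.
  - move=> x _; rewrite /= -EFinD lee_fin -real_normK ?num_real//; nra.
rewrite ge0_integralD//=.
- by rewrite integral_cst//= mul1e probability_setT lte_add_pinfty ?ltry.
- by move=> x _; rewrite lee_fin sqr_ge0.
- by apply/measurable_EFinP; exact: measurable_funX.
Qed.

Lemma integrable_mul_of_sqr (f g : T -> R) :
  measurable_fun setT f -> measurable_fun setT g ->
  (\int[P]_x (f x ^+ 2)%:E < +oo)%E -> (\int[P]_x (g x ^+ 2)%:E < +oo)%E ->
  P.-integrable setT (fun x => (f x * g x)%:E).
Proof.
move=> mf mg f2 g2; apply/integrableP; split.
  exact/measurable_EFinP/measurable_funM.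
apply: (@le_lt_trans _ _ (\int[P]_x ((f x ^+ 2)%:E + (g x ^+ 2)%:E)))%E.
  apply: ge0_le_integral => //.
  - apply: measurableT_comp => //; exact/measurable_EFinP/measurable_funM.
  - by apply/measurable_EFinP/measurable_funD; exact: measurable_funX.
  - move=> x _; rewrite /= -EFinD lee_fin normrM.
    by rewrite -(real_normK (num_real (f x))) -(real_normK (num_real (g x))); nra.
rewrite ge0_integralD//=.
- by rewrite lte_add_pinfty.
- by move=> x _; rewrite lee_fin sqr_ge0.
- by apply/measurable_EFinP; exact: measurable_funX.
- by move=> x _; rewrite lee_fin sqr_ge0.
- by apply/measurable_EFinP; exact: measurable_funX.
Qed.

(** Independence says that the joint law is the product of the marginals, so
    Fubini's theorem factors the integral; square integrability provides the
    integrability that Fubini requires. *)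
Lemma integral_mul_independent (X Y : {RV P >-> R}) :
  (forall A B : set R, measurable A -> measurable B ->
     P (X @^-1` A `&` Y @^-1` B) = P (X @^-1` A) * P (Y @^-1` B))%E ->
  (\int[P]_o (X o ^+ 2)%:E < +oo)%E -> (\int[P]_o (Y o ^+ 2)%:E < +oo)%E ->
  (\int[P]_o (Y o)%:E = 0)%E -> (\int[P]_o (X o * Y o)%:E = 0)%E.
Proof.
move=> indep X2 Y2 EY.
have mX : measurable_fun setT X by [].
have mY : measurable_fun setT Y by [].
pose XY (o : T) : R * R := (X o, Y o).
have mXY : measurable_fun setT XY by exact: measurable_fun_pair.
pose f (z : R * R) : \bar R := (z.1 * z.2)%:E.
have mf : measurable_fun setT f.
  by apply/measurable_EFinP/measurable_funM; [exact: measurable_fst|exact: measurable_snd].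
have if_ : P.-integrable setT (f \o XY) by exact: integrable_mul_of_sqr.
have law A : measurable A ->
    (distribution P X \x distribution P Y)%E A = pushforward P XY A.
  move=> mA.
  apply: (@product_measure_unique _ _ _ _ R (distribution P X) (distribution P Y) (pushforward P XY)) => //.
transitivity (\int[pushforward P XY]_z f z)%E.
  by rewrite integral_pushforward// preimage_setT.
transitivity (\int[distribution P X \x distribution P Y]_z f z)%E.
  by apply: eq_measure_integral => A mA _; exact/esym/law.
rewrite -integral12_prod_meas1.
  under eq_integral => x _.
    rewrite /fubini_F/= (_ : integral _ _ _ = 0)%E; last first.
      under eq_integral do rewrite /f/= EFinM.
      rewrite integralZl//.
        rewrite integral_pushforward// ?preimage_setT ?EY ?mule0//.
        exact: integrable_of_sqr.
      apply: integrable_pushforward => //; rewrite ?preimage_setT.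
      exact: integrable_of_sqr.
    over.
  by rewrite integral0.
have : (pushforward P XY).-integrable setT f.
  by apply: integrable_pushforward => //; rewrite preimage_setT.
move=> /integrableP[_ fi]; apply/integrableP; split => //.
by rewrite (@eq_measure_integral _ _ _ _ (pushforward P XY))// => A mA _; exact: law.
Qed.

(** The cross terms of the second moment of the sum vanish, so it is at most
    n v, and Markov's inequality applies to the square of the sum. *)
Lemma chebyshev_pairwise_independent (n : nat) (W : 'I_n -> {RV P >-> R})
    (v a : R) :
  (forall i j, i != j -> forall A B : set R, measurable A -> measurable B ->
     P (W i @^-1` A `&` W j @^-1` B) = P (W i @^-1` A) * P (W j @^-1` B))%E ->
  (forall i, \int[P]_o (W i o)%:E = 0)%E ->
  (forall i, \int[P]_o (W i o ^+ 2)%:E <= v%:E)%E ->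
  0 < a ->
  (P [set o | (a <= `|\sum_(i < n) W i o|)%R] <= (n%:R * v / a ^+ 2)%R%:E)%E.
Proof.
move=> indep W1 W2 a0.
have W2oo i : (\int[P]_o (W i o ^+ 2)%:E < +oo)%E.
  by rewrite (le_lt_trans (W2 i))// ltry.
have mS : measurable_fun setT (fun o => \sum_(i < n) W i o).
  exact: measurable_sum.
pose S : {RV P >-> R} := HB.pack (fun o => \sum_(i < n) W i o)
  (isMeasurableFun.Build _ _ _ _ _ mS).
have := @markov _ _ _ P S (fun x => x ^+ 2) a a0.
have -> : [set o | (a%:E <= `|(S o)%:E|)%E] = [set o | a <= `|\sum_(i < n) W i o|].
  by apply/seteqP; split => o /=; rewrite lee_fin.
move=> /(_ _ _ _)/wrap[].
- exact: measurable_funX.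
- by move=> r _; exact: sqr_ge0.
- by move=> x y x0 y0 xy; rewrite ler_pXn2r.
move=> H.
have a20 : 0 < a ^+ 2 by rewrite exprn_gt0.
rewrite mulrC EFinM lee_pdivlMl//; apply: (le_trans H).
have WW i j : P.-integrable setT (fun o => (W i o * W j o)%:E).
  exact: integrable_mul_of_sqr.
rewrite expectation.unlock.
rewrite (eq_integral (fun o => \sum_(i < n) \sum_(j < n) (W i o * W j o)%:E)%E); last first.
  move=> o _ /=; rewrite real_normK ?num_real// expr2 mulr_suml -sumEFin.
  by apply: eq_bigr => i _; rewrite mulr_sumr -sumEFin.
rewrite integral_sum//; last first.
  by move=> i; apply: integrable_sum.
apply: (@le_trans _ _ (\sum_(i < n) v%:E)%E); last first.
  by rewrite sumEFin sumr_const card_ord mulr_natl.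
apply: lee_sum => i _; rewrite integral_sum//.
rewrite (bigD1 i)//= big1 ?adde0.
  exact: W2.
move=> j ji; apply: integral_mul_independent => //.
by apply: indep; rewrite eq_sym.
Qed.

End pairwise_independence.

(** * Comparing two integrals against priors *)

Section evidence_comparison.
Context {R : realType}.
Local Notation mu := (@lebesgue_measure R).
Local Notation T2 := (measurableTypeR R * measurableTypeR R)%type.
Local Notation T3 := (measurableTypeR R * T2)%type.

Lemma integral_expRN_sqr (b : R) : 0 < b ->
  (\int[mu]_x (expR (- (b * x ^+ 2)))%:E = (Num.sqrt (pi / b))%:E)%E.
Proof.
move=> b0; pose s : R := Num.sqrt (b *+ 2)^-1.
have b20 : 0 < (b *+ 2)^-1 by rewrite invr_gt0 pmulrn_lgt0.
have s0 : 0 < s by rewrite sqrtr_gt0.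
have s2 : s ^+ 2 = (b *+ 2)^-1 by rewrite sqr_sqrtr// ltW.
have bn0 : b != 0 by rewrite gt_eqF.
have fE x : expR (- (b * x ^+ 2)) = (normal_peak s)^-1 * normal_pdf 0 s x.
  rewrite normal_pdfE ?gt_eqF// mulKf ?gt_eqF ?normal_peak_gt0 ?gt_eqF//.
  by rewrite /normal_fun subr0 s2; congr expR; field.
under eq_integral do rewrite fE EFinM.
rewrite ge0_integralZl_EFin//.
- rewrite integral_normal_pdf mule1 /normal_peak invrK s2; congr (Num.sqrt _)%:E.
  by field.
- by move=> x _; rewrite lee_fin normal_pdf_ge0.
- by apply/measurable_EFinP; exact: measurable_normal_pdf.
- by rewrite invr_ge0 normal_peak_ge0.
Qed.

Lemma measurable_variances : measurable (@variances R : set T2).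
Proof.
have -> : @variances R = [set` `]0%R, +oo[ ] `*` [set` `]0%R, +oo[ ].
  by apply/seteqP; split => -[a b]; rewrite /variances/= !in_itv/= !andbT.
by apply: measurableX.
Qed.

Lemma measurable_Theta : measurable (@Theta R : set T3).
Proof.
have -> : @Theta R = setT `*` @variances R.
  by apply/seteqP; split => -[a b] //= [].
by apply: measurableX => //; exact: measurable_variances.
Qed.

(** V' is meant to be fixed while the sample grows: this bound is only compared
    with quantities that are exponentially small relative to it, so the loss
    with respect to the true size of the integral does not matter. *)
Lemma evidence_ge (L0 p0 : T2 -> R) (V' : set T2) (c v' M1 : R) :
  measurable_fun (@variances R) L0 -> measurable_fun (@variances R) p0 ->
  (forall t, variances t -> 0 <= L0 t) -> (forall t, variances t -> 0 <= p0 t) ->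
  measurable V' -> V' `<=` @variances R -> 0 < c -> 0 < M1 ->
  (forall t, V' t -> c <= p0 t) -> (forall t, V' t -> M1 <= L0 t) ->
  (v'%:E <= @leb2 R V')%E ->
  ((c * v' * M1)%:E <= \int[@leb2 R]_(t in @variances R) (L0 t * p0 t)%:E)%E.
Proof.
move=> mL0 mp0 L0_ge0 p0_ge0 mV' V'v c0 M10 cp0 M1L0 vV'.
have mL0p0 : measurable_fun (@variances R : set T2) (fun t : T2 => (L0 t * p0 t)%:E).
  exact/measurable_EFinP/measurable_funM.
apply: (@le_trans _ _ (\int[@leb2 R]_(t in V') (M1 * c)%:E)%E).
  rewrite integral_cst//.
  rewrite (_ : c * v' * M1 = (M1 * c) * v'); last by ring.
  by rewrite EFinM lee_wpmul2l// lee_fin ltW// mulr_gt0.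
apply: (@le_trans _ _ (\int[@leb2 R]_(t in V') (L0 t * p0 t)%:E)%E).
  apply: ge0_le_integral => //.
  - by move=> t _; rewrite lee_fin ltW// mulr_gt0.
  - by apply: measurable_funS mL0p0 => //; exact: measurable_variances.
  - by move=> t V't; rewrite lee_fin ler_pM ?(ltW M10) ?(ltW c0)// ?M1L0// cp0.
apply: ge0_subset_integral => //; first exact: measurable_variances.
by move=> t vt; rewrite lee_fin mulr_ge0 ?L0_ge0 ?p0_ge0.
Qed.

Lemma evidence_lty (L0 p0 : T2 -> R) (M : R) :
  is_density (@leb2 R) (@variances R) p0 ->
  measurable_fun (@variances R) L0 -> (forall t, variances t -> 0 <= L0 t <= M) ->
  0 <= M ->
  (\int[@leb2 R]_(t in @variances R) (L0 t * p0 t)%:E < +oo)%E.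
Proof.
move=> [mp0 p0_ge0 intp0] mL0 L0M M0.
have mva := measurable_variances.
apply: (@le_lt_trans _ _ (\int[@leb2 R]_(t in @variances R) (M%:E * (p0 t)%:E))%E).
  apply: ge0_le_integral => //.
  - by move=> t vt; rewrite lee_fin mulr_ge0 ?p0_ge0//; case/andP: (L0M _ vt).
  - exact/measurable_EFinP/measurable_funM.
  - by apply: measurable_funeM; exact/measurable_EFinP.
  - move=> t vt; rewrite -EFinM lee_fin ler_wpM2r ?p0_ge0//.
    by case/andP: (L0M _ vt).
rewrite ge0_integralZl_EFin//.
- by rewrite intp0 mule1 ltry.
- exact/measurable_EFinP.
Qed.

(** Compares the evidence of a structure with a slope w
    (likelihood L, prior p) with that of the structure without (L0, p0).  On the
    region near the truth, |w| <= delta and t in V, the likelihood is dominated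
    by a product of a Gaussian function of w and L0, so that Tonelli's theorem
    yields the width sqrt (pi / b) of the Gaussian times the integral of L0 over
    V.  Elsewhere L <= M, and the prior p has mass 1; M is then measured against
    the lower bound of [evidence_ge] for the other evidence. *)
Lemma evidence_le (p L : T3 -> R) (p0 L0 : T2 -> R) (V V' : set T2)
    (delta K b C M c v' M1 : R) :
  is_density (@leb3 R) (@Theta R) p -> is_density (@leb2 R) (@variances R) p0 ->
  measurable_fun (@Theta R) L -> measurable_fun (@variances R) L0 ->
  (forall th, Theta th -> 0 <= L th) -> (forall t, variances t -> 0 <= L0 t) ->
  measurable V -> measurable V' -> V `<=` @variances R -> V' `<=` V ->
  0 < b -> 0 <= C -> 0 <= K -> 0 <= M -> 0 < c -> 0 < v' -> 0 < M1 ->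
  (forall w t, `|w| <= delta -> V t -> p (w, t) <= C) ->
  (forall w t, `|w| <= delta -> V t ->
     L (w, t) <= K * expR (- (b * w ^+ 2)) * L0 t) ->
  (forall w t, variances t -> ~ (`|w| <= delta /\ V t) -> L (w, t) <= M) ->
  (forall t, V t -> c <= p0 t) ->
  (v'%:E <= @leb2 R V')%E -> (forall t, V' t -> M1 <= L0 t) ->
  (\int[@leb3 R]_(th in @Theta R) (L th * p th)%:E <=
   (K * C * Num.sqrt (pi / b) / c + M / (c * v' * M1))%:E *
   \int[@leb2 R]_(t in @variances R) (L0 t * p0 t)%:E)%E.
Proof.
move=> [mp p_ge0 intp] [mp0 p0_ge0 intp0] mL mL0 L_ge0 L0_ge0 mV mV' Vv V'V b0 C0 K0 M0 c0 v'0 M10.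
move=> pC LK LM cp0 vV' M1L0.
have mTh := measurable_Theta; have mva := measurable_variances.
set ev3 := (\int[@leb2 R]_(t in _) _)%E.
have mL0p0 : measurable_fun (@variances R : set T2) (fun t : T2 => (L0 t * p0 t)%:E).
  exact/measurable_EFinP/measurable_funM.
have mL0V : measurable_fun V (fun t : T2 => (L0 t)%:E).
  by apply/measurable_EFinP; exact: measurable_funS mL0.
have ev3V A : measurable A -> A `<=` @variances R ->
    (\int[@leb2 R]_(t in A) (L0 t * p0 t)%:E <= ev3)%E.
  move=> mA Av; apply: ge0_subset_integral => //.
  by move=> t vt; rewrite lee_fin mulr_ge0 ?L0_ge0 ?p0_ge0.
have peak : (M%:E <= (M / (c * v' * M1))%:E * ev3)%E.
  rewrite (_ : M = M / (c * v' * M1) * (c * v' * M1)); last first.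
    by rewrite mulfVK// gt_eqF// !mulr_gt0.
  rewrite [in leLHS]EFinM mulfVK ?gt_eqF ?mulr_gt0//.
  rewrite lee_wpmul2l ?lee_fin ?divr_ge0 ?(ltW (mulr_gt0 (mulr_gt0 c0 v'0) M10))//.
  apply: (@evidence_ge _ _ V') => //; first exact: subset_trans Vv.
  by move=> t V't; rewrite cp0//; exact: V'V.
pose g (w : measurableTypeR R) : R := expR (- (b * w ^+ 2)).
pose h := (fun t : T2 => L0 t) \_ V.
have mg : measurable_fun setT g.
  apply: measurableT_comp => //; apply: measurableT_comp => //.
  by apply: measurable_funM => //; exact: measurable_funX.
have mh : measurable_fun setT h.
  by apply/(measurable_restrictT _ _).1 => //; exact: measurable_funS mL0.
have h0 t : 0 <= h t.
  rewrite /h patchE; case: ifPn => //; rewrite inE => Vt; exact/L0_ge0/Vv.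
have mgh : measurable_fun setT (fun th : T3 => g th.1 * h th.2).
  apply: measurable_funM; first exact: measurableT_comp measurable_fst.
  exact: measurableT_comp measurable_snd.
have KC0 : 0 <= K * C by rewrite mulr_ge0.
have g0 w : 0 <= g w by exact: expR_ge0.
have gh0 (th : T3) : (0%:E <= (g th.1 * h th.2)%:E)%E.
  by rewrite lee_fin mulr_ge0.
have intgh : (\int[@leb3 R]_th (g th.1 * h th.2)%:E =
    (Num.sqrt (pi / b))%:E * \int[@leb2 R]_t (h t)%:E)%E.
  have mgh' : measurable_fun setT (fun th : T3 => (g th.1 * h th.2)%:E).
    exact/measurable_EFinP.
  rewrite (@fubini_tonelli1 _ _ _ _ R mu (@leb2 R) _ mgh' gh0).
  have H0 : (0 <= \int[@leb2 R]_t (h t)%:E)%E.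
    by apply: integral_ge0 => t _; rewrite lee_fin.
  have mgE : measurable_fun setT (fun w => (g w)%:E) by exact/measurable_EFinP.
  have gE0 w : (setT w -> 0 <= (g w)%:E)%E by rewrite lee_fin.
  rewrite -integral_expRN_sqr// -(ge0_integralZr mu measurableT mgE gE0 H0).
  apply: eq_integral => w _; rewrite /fubini_F/=.
  under eq_integral do rewrite EFinM.
  rewrite ge0_integralZl_EFin//.
  - by move=> t _; rewrite lee_fin.
  - exact/measurable_EFinP.
have near_part : (\int[@leb3 R]_th (K * C * (g th.1 * h th.2))%:E <=
   (K * C * Num.sqrt (pi / b) / c)%:E * ev3)%E.
  under eq_integral do rewrite EFinM.
  rewrite ge0_integralZl_EFin//; last exact/measurable_EFinP.
  rewrite intgh (_ : _ / c = K * C * (Num.sqrt (pi / b) * c^-1)); last by rewrite mulrA.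
  rewrite [(K * C * _)%:E]EFinM -muleA lee_wpmul2l ?lee_fin//.
  rewrite [(Num.sqrt _ * _)%:E]EFinM -muleA lee_wpmul2l ?lee_fin ?sqrtr_ge0//.
  rewrite lee_pdivlMl//.
  apply: le_trans (ev3V _ mV Vv).
  have -> : (\int[@leb2 R]_t (h t)%:E = \int[@leb2 R]_(t in V) (L0 t)%:E)%E.
    by rewrite [RHS]integral_mkcond /h restrict_EFin.
  have L0V t : V t -> (0 <= (L0 t)%:E)%E by move=> Vt; rewrite lee_fin L0_ge0//; exact: Vv.
  rewrite -ge0_integralZl_EFin//; last exact: ltW.
  apply: ge0_le_integral => //.
  - by move=> t Vt; rewrite mule_ge0// ?L0V// lee_fin ltW.
  - exact: measurable_funeM.
  - by apply: measurable_funS mL0p0.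
  - by move=> t Vt; rewrite -EFinM lee_fin mulrC ler_wpM2l ?cp0// -lee_fin L0V.
have mKC : measurable_fun setT (fun th : T3 => (K * C * (g th.1 * h th.2))%:E).
  by apply/measurable_EFinP/measurable_funM.
have KCgh0 (th : T3) : (0%:E <= (K * C * (g th.1 * h th.2))%:E)%E.
  by rewrite lee_fin mulr_ge0// -lee_fin.
have mMp : measurable_fun (@Theta R : set T3) (fun th => (M%:E * (p th)%:E)%E).
  by apply: measurable_funeM; exact/measurable_EFinP.
have Mp0 (th : T3) : Theta th -> (0 <= M%:E * (p th)%:E)%E.
  by move=> Tth; rewrite mule_ge0// lee_fin ?p_ge0.
apply: (@le_trans _ _ (\int[@leb3 R]_(th in @Theta R) ((K * C * (g th.1 * h th.2))%:E + M%:E * (p th)%:E)))%E.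
  apply: ge0_le_integral => //.
  - by move=> th Tth; rewrite lee_fin mulr_ge0 ?L_ge0 ?p_ge0.
  - exact/measurable_EFinP/measurable_funM.
  - by apply: emeasurable_funD => //; exact: measurable_funTS mKC.
  - move=> [w t] Tth; rewrite -EFinM -EFinD lee_fin/=.
    have pwt := p_ge0 _ Tth.
    (* Adding both bounds at every point costs nothing and avoids splitting the
     domain of integration. *)
    have [near|far] := pselect (`|w| <= delta /\ V t).
      rewrite -[leLHS]addr0; apply: lerD; last by rewrite mulr_ge0.
      case: near => wd Vt; rewrite /h patchE mem_set//=.
      apply: (@le_trans _ _ (K * g w * L0 t * C)).
        by rewrite ler_pM ?L_ge0 ?pC ?LK.
      by rewrite le_eqVlt (_ : _ == _)//; apply/eqP; ring.
    rewrite -[leLHS]add0r; apply: lerD; first by have := KCgh0 (w, t); rewrite lee_fin.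
    by rewrite ler_wpM2r// LM.
rewrite ge0_integralD//=.
- rewrite EFinD ge0_muleDl; last 2 first.
  - by rewrite lee_fin divr_ge0 ?(ltW c0)// mulr_ge0 ?sqrtr_ge0.
  - by rewrite lee_fin divr_ge0// ltW// !mulr_gt0.
  apply: leeD.
    by apply: le_trans near_part; apply: ge0_subset_integral.
  have mpE : measurable_fun (@Theta R : set T3) (fun th => (p th)%:E).
    exact/measurable_EFinP.
  have pE0 (th : T3) : Theta th -> (0 <= (p th)%:E)%E.
    by move=> Tth; rewrite lee_fin p_ge0.
  by rewrite (ge0_integralZl_EFin _ mTh pE0 mpE M0) intp mule1.
- exact: measurable_funTS mKC.
Qed.
End evidence_comparison.

(** * The Gaussian deviance *)

Section deviance.
Context {R : realType}.
Implicit Types (p N n : nat) (s t k x : R).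

(** Up to a constant, minus twice the log-likelihood of p centred Gaussian
    observations with sum of squares k under the variance t. *)
Definition deviance p k t : R := p%:R * ln t + k / t.

(** In the variable z = sqrt (s / t) the logarithm becomes ln s - 2 ln z, and
    ln z <= z - 1 bounds the deviance below by a quadratic polynomial.  The
    lower bounds on the deviance that follow are then algebraic inequalities. *)
Lemma deviance_ge p s t k x : 0 < s -> 0 < t -> p%:R * s * x <= k ->
  exists2 z : R, 0 < z /\ z ^+ 2 = s / t &
    p%:R * (ln s + 2 - 2 * z + x * z ^+ 2) <= deviance p k t.
Proof.
move=> s0 t0 kx; have st0 : 0 < s / t by rewrite divr_gt0.
exists (Num.sqrt (s / t)).
  by rewrite sqrtr_gt0 st0 sqr_sqrtr// ltW.
have z2 : Num.sqrt (s / t) ^+ 2 = s / t by rewrite sqr_sqrtr// ltW.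
have z0 : 0 < Num.sqrt (s / t) by rewrite sqrtr_gt0.
have lnz : ln (Num.sqrt (s / t)) <= Num.sqrt (s / t) - 1.
  have := @le_ln1Dx R (Num.sqrt (s / t) - 1).
  by rewrite (_ : 1 + _ = Num.sqrt (s / t)); [apply; lra|ring].
have lnst : 2 * ln (Num.sqrt (s / t)) = ln s - ln t.
  rewrite -ln_div ?posrE// -[in RHS]z2 expr2 lnM ?posrE//; ring.
rewrite z2 /deviance.
have h : p%:R * (x * (s / t)) <= k / t.
  rewrite ler_pdivlMr// (le_trans _ kx)// le_eqVlt; apply/orP; left; apply/eqP.
  by field; rewrite gt_eqF.
apply: le_trans (lerD (lexx _) h); rewrite -mulrDr ler_wpM2l// lerD2r; lra.
Qed.

(** The deviance cannot fall much below its value p (ln s + 1) at k = p s and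
    t = s as long as k is not much smaller than p s. *)
Lemma deviance_base p s t k (e : R) : 0 < s -> 0 < t -> 0 <= e <= 2^-1 ->
  p%:R * s * (1 - e) <= k -> p%:R * (ln s + 1 - 2 * e) <= deviance p k t.
Proof.
move=> s0 t0 e01 /(deviance_ge s0 t0)[z [z0 _]]; apply: le_trans.
rewrite ler_wpM2l//.
have : 0 <= (1 - 2 * e) * (z - 1) ^+ 2 by rewrite mulr_ge0 ?sqr_ge0//; lra.
have : 0 <= e * (z - 2) ^+ 2 by rewrite mulr_ge0 ?sqr_ge0//; lra.
lra.
Qed.

(** A sum of squares that is too large by a factor 1 + r cannot be compensated
    by any variance t. *)
Lemma deviance_big p s t k (r : R) : 0 < s -> 0 < t -> 0 <= r <= 1 ->
  p%:R * s * (1 + r) <= k -> p%:R * (ln s + 1 + r / 2) <= deviance p k t.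
Proof.
move=> s0 t0 r01 /(deviance_ge s0 t0)[z [z0 _]]; apply: le_trans.
rewrite ler_wpM2l//.
suff : 0 <= (1 + r) * z ^+ 2 - 2 * z + 1 - r / 2 by lra.
have : 0 <= ((1 + r) * z - 1) ^+ 2 by exact: sqr_ge0.
nra.
Qed.

(** The term (z - 1)^2 of the quadratic lower bound is at least (dl / 4)^2 when
    t / s = z^-2 is at distance dl from 1, and the relative error e on k is too
    small to compensate for it. *)
Lemma deviance_off p s t k (e dl : R) : 0 < s -> 0 < t -> 0 <= e ->
  0 < dl < 1 -> e <= dl ^+ 2 / 128 -> dl <= `|t / s - 1| ->
  p%:R * s * (1 - e) <= k -> p%:R * (ln s + 1 + dl ^+ 2 / 32) <= deviance p k t.
Proof.
move=> s0 t0 e0 dl01 edl tdl /(deviance_ge s0 t0)[z [z0 z2]]; apply: le_trans.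
rewrite ler_wpM2l//.
have zdl : dl / 4 <= `|z - 1|.
  rewrite leNgt; apply/negP => zlt; move: tdl; rewrite leNgt => /negP; apply.
  have -> : t / s = (z ^+ 2)^-1 by rewrite z2 invf_div.
  have z20 : 0 < z ^+ 2 by rewrite exprn_gt0.
  have -> : (z ^+ 2)^-1 - 1 = (1 - z ^+ 2) / z ^+ 2 by field; rewrite gt_eqF.
  rewrite normrM [`|_^-1|]gtr0_norm ?invr_gt0// ltr_pdivrMr//.
  pose a := dl / 4; have dlE : dl = 4 * a by rewrite /a; lra.
  move: zlt; rewrite -/a dlE !ltr_norml => /andP[za1 za2].
  have a01 : 0 < a < 4^-1 by rewrite /a; lra.
  have l1 : (1 - a) ^+ 2 < z ^+ 2 by rewrite ltr_pXn2r ?nnegrE//; lra.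
  have l2 : z ^+ 2 < (1 + a) ^+ 2 by rewrite ltr_pXn2r ?nnegrE//; lra.
  apply/andP; split.
  - have : (1 - 4 * a) * z ^+ 2 <= (1 - 4 * a) * (1 + a) ^+ 2.
      by rewrite ler_wpM2l ?(ltW l2)//; lra.
    have : 0 < a * (2 + 7 * a + 4 * a ^+ 2) by rewrite mulr_gt0//; nra.
    lra.
  - have : (1 + 4 * a) * (1 - a) ^+ 2 <= (1 + 4 * a) * z ^+ 2.
      by rewrite ler_wpM2l ?(ltW l1)//; lra.
    have : 0 < a * (2 - 7 * a + 4 * a ^+ 2) by rewrite mulr_gt0//; nra.
    lra.
have : (dl / 4) ^+ 2 <= (z - 1) ^+ 2.
  by rewrite -[leRHS]real_normK ?num_real// ler_pXn2r ?nnegrE//; lra.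
have e1 : e <= 8^-1 by nra.
have : 0 <= (8^-1 - e) * (z - 1) ^+ 2 by rewrite mulr_ge0 ?sqr_ge0//; lra.
have : 0 <= e * (z - 2) ^+ 2 by rewrite mulr_ge0 ?sqr_ge0//; lra.
lra.
Qed.

Lemma deviance_peak p s t k (e : R) : 0 < s -> s <= t <= s * (1 + e) -> 0 <= e ->
  0 <= k <= p%:R * s * (1 + e) -> deviance p k t <= p%:R * (ln s + 1 + 2 * e).
Proof.
move=> s0 /andP[st tse] e0 /andP[k0 kse].
have t0 : 0 < t by exact: lt_le_trans st.
have kt : k / t <= p%:R * (1 + e).
  rewrite ler_pdivrMr// (le_trans kse)// mulrAC ler_wpM2l ?mulr_ge0//; lra.
have lnt : ln t <= ln s + e.
  have : ln (t / s) <= e.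
    apply: le_trans (_ : ln (1 + e) <= _); last by apply: le_ln1Dx; lra.
    by rewrite ler_ln ?posrE ?divr_gt0//; [rewrite ler_pdivrMr// mulrC|lra].
  by rewrite ln_div ?posrE//; lra.
rewrite /deviance [leRHS](_ : _ = p%:R * (ln s + e) + p%:R * (1 + e)); last by ring.
by rewrite lerD// ler_wpM2l.
Qed.

Definition gauss_lik N n (C D : R) (t : R * R) : R :=
  expR (- ((deviance N C t.1 + deviance n D t.2) / 2)).

(** The value of the two deviances at variances s when each sum of squares
    equals its expectation. *)
Definition deviance_at N n (s : R * R) : R :=
  N%:R * (ln s.1 + 1) + n%:R * (ln s.2 + 1).

Lemma gauss_lik_le N n (C D e : R) (s t : R * R) : variances s -> variances t ->
  0 <= e <= 2^-1 -> (n <= N)%N ->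
  N%:R * s.1 * (1 - e) <= C -> n%:R * s.2 * (1 - e) <= D ->
  gauss_lik N n C D t <= expR (- ((deviance_at N n s - 4 * e * N%:R) / 2)).
Proof.
move=> [s1 s2] [t1 t2] e01 nN hC hD.
have := deviance_base s1 t1 e01 hC; have := deviance_base s2 t2 e01 hD.
rewrite ler_expR /deviance_at; move: nN; rewrite -(ler_nat R); nra.
Qed.

(** Four ways of being far from the truth s: one of the two variances is wrong,
    or the slope inflates one of the two sums of squares.  The deviance
    concerned gains at least n g, while the other one loses at most 2 e N. *)
Lemma gauss_lik_far N n (C D e dl r g : R) (s t : R * R) :
  variances s -> variances t ->
  0 <= e <= dl ^+ 2 / 128 -> 0 < dl < 1 -> 0 <= r <= 1 -> (n <= N)%N ->
  0 <= g -> g <= dl ^+ 2 / 32 -> g <= r / 2 ->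
  N%:R * s.1 * (1 - e) <= C -> n%:R * s.2 * (1 - e) <= D ->
  [\/ dl <= `|t.1 / s.1 - 1|, dl <= `|t.2 / s.2 - 1|,
      N%:R * s.1 * (1 + r) <= C | n%:R * s.2 * (1 + r) <= D] ->
  gauss_lik N n C D t <= expR (- ((deviance_at N n s + n%:R * g - 4 * e * N%:R) / 2)).
Proof.
move=> [s1 s2] [t1 t2] /andP[e0 edl] dl01 r01 nN g0 gdl gr hC hD H.
have e01 : 0 <= e <= 2^-1 by nra.
have b1 := deviance_base s1 t1 e01 hC; have b2 := deviance_base s2 t2 e01 hD.
have nN' : n%:R <= N%:R :> R by rewrite ler_nat.
have n0 : 0 <= n%:R :> R by [].
have N0 : 0 <= N%:R :> R by [].
have Ne0 : 0 <= N%:R * e by exact: mulr_ge0.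
rewrite ler_expR lerN2 ler_pM2r ?invr_gt0// /deviance_at.
case: H => H.
- have := deviance_off s1 t1 e0 dl01 edl H hC.
  have : N%:R * g <= N%:R * (dl ^+ 2 / 32) by rewrite ler_wpM2l.
  have : n%:R * g <= N%:R * g by rewrite ler_wpM2r.
  have : n%:R * e <= N%:R * e by rewrite ler_wpM2r.
  lra.
- have := deviance_off s2 t2 e0 dl01 edl H hD.
  have : n%:R * g <= n%:R * (dl ^+ 2 / 32) by rewrite ler_wpM2l.
  have : n%:R * e <= N%:R * e by rewrite ler_wpM2r.
  lra.
- have := deviance_big s1 t1 r01 H.
  have : N%:R * g <= N%:R * (r / 2) by rewrite ler_wpM2l.
  have : n%:R * g <= N%:R * g by rewrite ler_wpM2r.
  have : n%:R * e <= N%:R * e by rewrite ler_wpM2r.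
  lra.
- have := deviance_big s2 t2 r01 H.
  have : n%:R * g <= n%:R * (r / 2) by rewrite ler_wpM2l.
  have : n%:R * e <= N%:R * e by rewrite ler_wpM2r.
  lra.
Qed.

Lemma gauss_lik_peak_le N n (C D e : R) (s t : R * R) : variances s ->
  0 <= e -> (n <= N)%N ->
  s.1 <= t.1 <= s.1 * (1 + e) -> s.2 <= t.2 <= s.2 * (1 + e) ->
  0 <= C <= N%:R * s.1 * (1 + e) -> 0 <= D <= n%:R * s.2 * (1 + e) ->
  expR (- ((deviance_at N n s + 4 * e * N%:R) / 2)) <= gauss_lik N n C D t.
Proof.
move=> [s1 s2] e0 nN t1 t2 hC hD.
rewrite ler_expR lerN2 ler_pM2r ?invr_gt0// /deviance_at.
have := deviance_peak s1 t1 e0 hC; have := deviance_peak s2 t2 e0 hD.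
have : n%:R * e <= N%:R * e :> R by rewrite ler_wpM2r// ler_nat.
lra.
Qed.

(** C' and D' stand for the sums of squares after fitting a slope w; a slope
    acts on one of them only, hence the disjunction.  The gain k and the loss
    a w^2 are divided by a variance between tm and tM. *)
Lemma gauss_lik_near N n (C D C' D' a k tm tM : R) (w : R) (t : R * R) :
  0 < tm -> 0 <= a -> 0 <= k ->
  tm <= t.1 <= tM -> tm <= t.2 <= tM ->
  (C + a * w ^+ 2 - k <= C' /\ D <= D') \/
  (C <= C' /\ D + a * w ^+ 2 - k <= D') ->
  gauss_lik N n C' D' t <=
    expR (k / (2 * tm)) * expR (- (a / (2 * tM) * w ^+ 2)) * gauss_lik N n C D t.
Proof.
move=> tm0 a0 k0 /andP[m1 M1] /andP[m2 M2] H.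
have aux (E E' u : R) : tm <= u -> u <= tM -> E + a * w ^+ 2 - k <= E' ->
    E / u + a / tM * w ^+ 2 - k / tm <= E' / u.
  move=> mu uM EE'; have u0 : 0 < u by exact: lt_le_trans mu.
  have : k / u <= k / tm by rewrite ler_wpM2l// lef_pV2.
  have : a / tM * w ^+ 2 <= a / u * w ^+ 2.
    by rewrite ler_wpM2r ?sqr_ge0// ler_wpM2l// lef_pV2// posrE (lt_le_trans u0).
  have : (E + a * w ^+ 2 - k) / u <= E' / u by rewrite ler_wpM2r// invr_ge0 ltW.
  rewrite !mulrDl; lra.
have aux0 (E E' u : R) : tm <= u -> E <= E' -> E / u <= E' / u.
  by move=> mu EE'; rewrite ler_wpM2r// invr_ge0 ltW// (lt_le_trans tm0).
have tM0 : 0 < tM by rewrite (lt_le_trans tm0)// (le_trans m1).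
rewrite -!expRD ler_expR /deviance.
have -> : k / (2 * tm) = k / tm / 2 by field; rewrite gt_eqF.
have -> : a / (2 * tM) * w ^+ 2 = a / tM * w ^+ 2 / 2 by field; rewrite gt_eqF.
case: H => -[H1 H2].
- by have := aux _ _ _ m1 M1 H1; have := aux0 _ _ _ m2 H2; lra.
- by have := aux _ _ _ m2 M2 H2; have := aux0 _ _ _ m1 H1; lra.
Qed.

End deviance.

(** * The three likelihoods as one Gaussian likelihood *)

Section likelihood.
Context {R : realType}.
Implicit Types (n m : nat) (t w y : R).

Lemma normal_pdf_deviance (mean t x : R) : 0 < t ->
  normal_pdf mean (Num.sqrt t) x =
  normal_peak 1 * expR (- (deviance 1 ((x - mean) ^+ 2) t / 2)).
Proof.
move=> t0; rewrite normal_pdfE ?gt_eqF ?sqrtr_gt0//.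
rewrite /normal_peak /normal_fun sqr_sqrtr ?ltW// expr1n mul1r /deviance mul1r.
have -> : - ((ln t + (x - mean) ^+ 2 / t) / 2) =
    - (ln t / 2) + - (x - mean) ^+ 2 / (t *+ 2) by field; rewrite gt_eqF.
have sqrtt : expR (ln t / 2) = Num.sqrt t.
  apply/eqP; rewrite -(eqrXn2 (ltn0Sn 1)) ?expR_ge0 ?sqrtr_ge0//.
  by rewrite -expRM_natr mulfVK// lnK ?posrE// sqr_sqrtr ?ltW.
rewrite expRD expRN sqrtt -mulrnAr sqrtrM ?ltW// invfM; ring.
Qed.

Lemma prod_normal_pdf n (mean x : 'I_n -> R) t : 0 < t ->
  \prod_(i < n) normal_pdf (mean i) (Num.sqrt t) (x i) =
  normal_peak 1 ^+ n * expR (- (deviance n (\sum_(i < n) (x i - mean i) ^+ 2) t / 2)).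
Proof.
move=> t0; under eq_bigr do rewrite normal_pdf_deviance//.
rewrite big_split/= prodr_const card_ord -expR_sum; congr (_ * expR _).
rewrite sumrN -mulr_suml; congr (- (_ / 2)).
by rewrite /deviance big_split/= sumr_const card_ord -mulr_suml mul1r mulr_natl.
Qed.

(** The interventional samples appear in this sum only: under the intervention
    on the second coordinate, the equation of the first one is all that is
    left. *)
Definition resid1 (y : R) n m (xs : 'I_n -> R * R) (ys : 'I_m -> R * R) (w : R) : R :=
  \sum_(i < n) ((xs i).1 - w * (xs i).2) ^+ 2 + \sum_(j < m) ((ys j).1 - w * y) ^+ 2.

Definition resid2 n (xs : 'I_n -> R * R) (w : R) : R :=
  \sum_(i < n) ((xs i).2 - w * (xs i).1) ^+ 2.

(** The slope of the first coordinate on the second, and of the second on the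
    first.  At most one of them is nonzero, which makes the three structures
    instances of one model. *)
Definition slope1 (S : structure) w : R := if S is S1 then w else 0.
Definition slope2 (S : structure) w : R := if S is S2 then w else 0.

Lemma likelihoodE y n m (xs : 'I_n -> R * R) (ys : 'I_m -> R * R) S w (t : R * R) :
  variances t ->
  likelihood y xs ys S (w, t) = normal_peak 1 ^+ (n + m + n) *
    gauss_lik (n + m) n (resid1 y xs ys (slope1 S w)) (resid2 xs (slope2 S w)) t.
Proof.
case: t => t1 t2 [/= t10 t20].
have -> : likelihood y xs ys S (w, (t1, t2)) =
  (\prod_(i < n) normal_pdf (slope1 S w * (xs i).2) (Num.sqrt t1) (xs i).1) *
  (\prod_(i < n) normal_pdf (slope2 S w * (xs i).1) (Num.sqrt t2) (xs i).2) *
  (\prod_(j < m) normal_pdf (slope1 S w * y) (Num.sqrt t1) (ys j).1).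
  rewrite /likelihood -big_split/=; congr (_ * _).
    by apply: eq_bigr => i _; case: S => /=; rewrite ?mul0r// mulrC.
  by apply: eq_bigr => j _; rewrite /int_pdf/=; case: S => /=; rewrite ?mul0r.
rewrite !prod_normal_pdf// /gauss_lik /=.
set A := \sum_(i < n) _; set B := \sum_(i < n) _; set C := \sum_(j < m) _.
have -> : deviance (n + m) (resid1 y xs ys (slope1 S w)) t1 = deviance n A t1 + deviance m C t1.
  by rewrite /deviance /resid1 -/A -/C natrD; ring.
rewrite -/B !exprD [in RHS]mulrC.
have -> : - ((deviance n A t1 + deviance m C t1 + deviance n B t2) / 2) =
  - (deviance n A t1 / 2) + - (deviance n B t2 / 2) + - (deviance m C t1 / 2) by lra.
by rewrite !expRD; ring.
Qed.

Lemma resid1E y n m (xs : 'I_n -> R * R) (ys : 'I_m -> R * R) w :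
  resid1 y xs ys w = resid1 y xs ys 0
   - 2 * w * (\sum_(i < n) (xs i).1 * (xs i).2 + \sum_(j < m) y * (ys j).1)
   + w ^+ 2 * (\sum_(i < n) (xs i).2 ^+ 2 + m%:R * y ^+ 2).
Proof.
rewrite /resid1 mulrDr mulrDr !mulr_sumr.
have -> : w ^+ 2 * (m%:R * y ^+ 2) = \sum_(j < m) w ^+ 2 * y ^+ 2.
  by rewrite sumr_const card_ord -mulr_natl; ring.
rewrite !opprD !addrA. 
rewrite (_ : forall a b c d e f : R, a + b - c - d + e + f = (a - c + e) + (b - d + f)); last first.
  by move=> *; ring.
rewrite -!sumrB -!big_split/=; congr (_ + _); apply: eq_bigr => i _; ring.
Qed.

Lemma resid2E n (xs : 'I_n -> R * R) w :
  resid2 xs w = resid2 xs 0 - 2 * w * (\sum_(i < n) (xs i).1 * (xs i).2)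
   + w ^+ 2 * (\sum_(i < n) (xs i).1 ^+ 2).
Proof.
rewrite /resid2 !mulr_sumr -sumrB -big_split/=; apply: eq_bigr => i _; ring.
Qed.

(** Half of the curvature is given up so that completing the square bounds
    the linear term: a w^2 / 2 - 2 w B + 2 B^2 / a is a square. *)
Lemma quadratic_ge (A B a k w : R) : 0 < a -> a <= A -> B ^+ 2 <= k * a ->
  a / 2 * w ^+ 2 - 2 * k <= - (2 * w * B) + w ^+ 2 * A.
Proof.
move=> a0 aA Bk.
have : 0 <= (a * w - 2 * B) ^+ 2 by exact: sqr_ge0.
have : w ^+ 2 * a <= w ^+ 2 * A by rewrite ler_wpM2l// sqr_ge0.
move=> h1 h2; apply: (@le_trans _ _ (- (2 * w * B) + w ^+ 2 * a)); last by lra.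
rewrite -(ler_pM2l a0); nra.
Qed.

Lemma measurable_gauss_lik d (T : measurableType d) (E : set T) N n (C D : T -> R)
    (t : T -> R * R) : (forall z, E z -> variances (t z)) ->
  measurable_fun E C -> measurable_fun E D ->
  measurable_fun E (fun z => (t z).1) -> measurable_fun E (fun z => (t z).2) ->
  measurable_fun E (fun z => gauss_lik N n (C z) (D z) (t z)).
Proof.
move=> Et mC mD mt1 mt2.
(* On positive reals the inverse is the power -1, which is known to be
   measurable on the whole line. *)
pose dv N (C : T -> R) (u : T -> R) z := N%:R * ln (u z) + C z * (u z) `^ (- 1).
have mdv N' C' u : measurable_fun E C' -> measurable_fun E u ->
    measurable_fun E (dv N' C' u).
  move=> mC' mu; apply: measurable_funD.
    by apply: measurable_funM => //; exact: measurableT_comp.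
  apply: measurable_funM => //.
  exact: (measurableT_comp (measurable_powR (- 1))).
apply: (eq_measurable_fun (fun z => expR (- ((dv N C (fun z => (t z).1) z + dv n D (fun z => (t z).2) z) / 2)))).
  move=> z; rewrite inE => /Et[t1 t2]; rewrite /gauss_lik /deviance /dv.
  by rewrite !powR_inv1 ?ltW.
apply: measurableT_comp => //; apply: measurableT_comp => //.
by apply: measurable_funM => //; apply: measurable_funD; exact: mdv.
Qed.

Lemma measurable_resid1 d (T : measurableType d) (E : set T) y n m
    (xs : 'I_n -> T -> R * R) (ys : 'I_m -> T -> R * R) (w : T -> R) :
  (forall i, measurable_fun E (xs i)) -> (forall j, measurable_fun E (ys j)) ->
  measurable_fun E w ->
  measurable_fun E (fun z => resid1 y (xs^~ z) (ys^~ z) (w z)).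
Proof.
move=> mx my mw; apply: measurable_funD; apply: measurable_sum => i;
  apply: measurable_funX; apply: measurable_funB.
- exact: (measurableT_comp measurable_fst (mx i)).
- by apply: measurable_funM => //; exact: (measurableT_comp measurable_snd (mx i)).
- exact: (measurableT_comp measurable_fst (my i)).
- exact: measurable_funM.
Qed.

Lemma measurable_resid2 d (T : measurableType d) (E : set T) n
    (xs : 'I_n -> T -> R * R) (w : T -> R) :
  (forall i, measurable_fun E (xs i)) -> measurable_fun E w ->
  measurable_fun E (fun z => resid2 (xs^~ z) (w z)).
Proof.
move=> mx mw; apply: measurable_sum => i; apply: measurable_funX; apply: measurable_funB.
- exact: (measurableT_comp measurable_snd (mx i)).
- by apply: measurable_funM => //; exact: (measurableT_comp measurable_fst (mx i)).
Qed.

End likelihood.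

(** * Evidence of a structure with one edge against independence *)

Section evidence_ratio.
Context {R : realType}.
Local Notation T2 := (measurableTypeR R * measurableTypeR R)%type.
Local Notation T3 := (measurableTypeR R * T2)%type.

Definition box (s : R * R) (dl : R) : set (R * R) :=
  [set t | `|t.1 / s.1 - 1| <= dl /\ `|t.2 / s.2 - 1| <= dl].

Lemma itv_ratio (s u dl : R) : 0 < s ->
  (`|u / s - 1| <= dl) = (s * (1 - dl) <= u <= s * (1 + dl)).
Proof.
move=> s0; rewrite ler_distl ler_pdivlMr// ler_pdivrMr//.
by rewrite (mulrC s (1 - dl)) (mulrC s (1 + dl)).
Qed.

Lemma boxE (s : R * R) (dl : R) : variances s ->
  box s dl = `[s.1 * (1 - dl), s.1 * (1 + dl)] `*` `[s.2 * (1 - dl), s.2 * (1 + dl)].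
Proof.
move=> [s1 s2]; apply/seteqP; split => t /=; rewrite /box/= !in_itv/=.
  by rewrite !itv_ratio// => -[].
by rewrite !itv_ratio// => -[].
Qed.

(** The rectangle on which the likelihood of the independence structure is
    bounded below.  It lies above s, so that k / t <= k / s there, and it
    touches s, where the prior is positive. *)
Definition corner (s : R * R) (e : R) : set (R * R) :=
  `[s.1, s.1 * (1 + e)] `*` `[s.2, s.2 * (1 + e)].

Lemma leb2_corner (s : R * R) (e : R) : variances s -> 0 < e ->
  @leb2 R (corner s e : set T2) = (s.1 * e * (s.2 * e))%:E.
Proof.
move=> [s1 s2] e0; rewrite /leb2 product_measure1E//= !lebesgue_measure_itv/=.
rewrite !lte_fin !ltr_pMr// ltrDl e0 -!EFinB -EFinM; congr (_ %:E); ring.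
Qed.

Lemma sub_corner_box (s : R * R) (e dl : R) : variances s -> 0 <= dl -> e <= dl ->
  corner s e `<=` box s dl.
Proof.
move=> vs dl0 edl t; have [s1 s2] := vs; rewrite boxE// /corner /=.
rewrite !in_itv/= => -[/andP[a b]] /andP[c f].
split; apply/andP; split; nra.
Qed.

Lemma box_bounds (s t : R * R) (dl : R) : variances s -> 0 < dl < 1 -> box s dl t ->
  Num.min s.1 s.2 * (1 - dl) <= t.1 <= Num.max s.1 s.2 * 2 /\
  Num.min s.1 s.2 * (1 - dl) <= t.2 <= Num.max s.1 s.2 * 2.
Proof.
move=> vs dl01; rewrite boxE//; case: vs => s1 s2 [/=].
rewrite !in_itv/= => /andP[a b] /andP[c f].
have m1 : Num.min s.1 s.2 <= s.1 by rewrite ge_min lexx.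
have m2 : Num.min s.1 s.2 <= s.2 by rewrite ge_min lexx orbT.
have M1 : s.1 <= Num.max s.1 s.2 by rewrite le_max lexx.
have M2 : s.2 <= Num.max s.1 s.2 by rewrite le_max lexx orbT.
by split; apply/andP; split; nra.
Qed.

Lemma expRN_le_inv_sqrt (h : R) (N : nat) : 0 < h -> (0 < N)%N ->
  expR (- (h * N%:R)) <= (h * Num.sqrt N%:R)^-1.
Proof.
move=> h0 N0; rewrite expRN lef_pV2 ?posrE ?expR_gt0//; last first.
  by rewrite mulr_gt0// sqrtr_gt0 ltr0n.
apply: le_trans (expR_ge1Dx _); apply: (@le_trans _ _ (h * N%:R)); last by rewrite lerDr.
rewrite ler_wpM2l ?(ltW h0)//.
have N1 : 1 <= Num.sqrt N%:R :> R by rewrite -[leLHS]sqrtr1 ler_sqrt// ler1n.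
have := sqr_sqrtr (ler0n R N); rewrite expr2; nra.
Qed.

(** Cq w and Dq w are the sums of squares after fitting the slope w, and C and D
    those without slope, which must have relative error at most e.  The
    constants e, K and N0 depend on the priors and the true variances s, but
    neither on the sample nor on its size. *)
Lemma gauss_lik_evidence_ratio (p : T3 -> R) (p0 : T2 -> R) (s : R * R)
    (dl Cp c h a0 k0 : R) :
  is_density (@leb3 R) (@Theta R) p -> is_density (@leb2 R) (@variances R) p0 ->
  variances s -> 0 < dl < 1 -> 0 <= Cp -> 0 < c -> 0 < h <= 1 -> 0 < a0 -> 0 <= k0 ->
  (forall w t, `|w| <= dl -> box s dl t -> p (w, t) <= Cp) ->
  (forall t, box s dl t -> c <= p0 t) ->
  exists e K N0 : R, [/\ 0 < e <= dl, 0 <= K & forall (N n : nat) (cst C D : R) (Cq Dq : R -> R),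
    N0 <= N%:R -> (0 < N)%N -> (n <= N)%N -> h * N%:R <= n%:R -> 0 < cst ->
    measurable_fun setT Cq -> measurable_fun setT Dq ->
    N%:R * s.1 * (1 - e) <= C <= N%:R * s.1 * (1 + e) ->
    n%:R * s.2 * (1 - e) <= D <= n%:R * s.2 * (1 + e) ->
    (forall w, C + a0 * N%:R * w ^+ 2 - k0 <= Cq w /\ D <= Dq w) \/
    (forall w, C <= Cq w /\ D + a0 * N%:R * w ^+ 2 - k0 <= Dq w) ->
    (\int[@leb3 R]_(th in @Theta R) (cst * gauss_lik N n (Cq th.1) (Dq th.1) th.2 * p th)%:E <=
     (K / Num.sqrt N%:R)%:E *
     \int[@leb2 R]_(t in @variances R) (cst * gauss_lik N n C D t * p0 t)%:E)%E].
Proof.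
move=> dp dp0 vs dl01 Cp0 c0 h01 a00 k00 pC cp0.
have /andP[dl0 dl1] := dl01; have /andP[h0 h1] := h01.
have [s1 s2] := vs.
pose smin := Num.min s.1 s.2.
have smin0 : 0 < smin by rewrite lt_min s1 s2.
have smin1 : smin <= s.1 by rewrite ge_min lexx.
have smin2 : smin <= s.2 by rewrite ge_min lexx orbT.
pose tm := smin * (1 - dl).
pose tM := Num.max s.1 s.2 * 2.
have M1 : s.1 * 2 <= tM by rewrite ler_wpM2r// le_max lexx.
have M2 : s.2 * 2 <= tM by rewrite ler_wpM2r// le_max lexx orbT.
have tM0 : 0 < tM by apply: lt_le_trans M1; rewrite mulr_gt0.
have tm0 : 0 < tm by rewrite mulr_gt0// subr_gt0.
(* A slope of size at least dl adds a0 N dl^2 to one of the sums of squares,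
   a relative increase of at least 2 q; r is a part of it that survives the
   gain k0 and the sampling error. *)
pose q := a0 * dl ^+ 2 / tM.
have q0 : 0 < q by rewrite divr_gt0// mulr_gt0// exprn_gt0.
have s1q : s.1 * q <= a0 * dl ^+ 2 / 2.
  have : q * (s.1 * 2) <= q * tM by rewrite ler_wpM2l// ltW.
  by rewrite {2}/q divfK ?gt_eqF//; lra.
have s2q : s.2 * q <= a0 * dl ^+ 2 / 2.
  have : q * (s.2 * 2) <= q * tM by rewrite ler_wpM2l// ltW.
  by rewrite {2}/q divfK ?gt_eqF//; lra.
pose r := Num.min 1 (q / 4).
have r0 : 0 < r by rewrite lt_min ltr01/= divr_gt0.
have r1 : r <= 1 by rewrite ge_min lexx.
have rq : r <= q / 4 by rewrite ge_min lexx orbT.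
pose g := Num.min (dl ^+ 2 / 32) (r / 2).
have dl20 : 0 < dl ^+ 2 by rewrite exprn_gt0.
have g0 : 0 < g by rewrite lt_min !divr_gt0.
have gdl : g <= dl ^+ 2 / 32 by rewrite ge_min lexx.
have gr : g <= r / 2 by rewrite ge_min lexx orbT.
(* E = 2 e is the relative error on the sums of squares left by the slope. The
   bound h g / 12 lets the gain n g >= h N g beat the loss 4 E N of the far
   region and the loss 4 e N = 2 E N of the corner. *)
pose E := Num.min (Num.min (dl ^+ 2 / 128) (q / 4)) (h * g / 12).
have hg0 : 0 < h * g by exact: mulr_gt0.
have E0 : 0 < E by rewrite !lt_min (divr_gt0 dl20)// (divr_gt0 q0)// (divr_gt0 hg0).
have Edl : E <= dl ^+ 2 / 128 by rewrite !ge_min lexx.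
have Eq : E <= q / 4 by rewrite !ge_min lexx orbT.
have Eh : E <= h * g / 12 by rewrite !ge_min lexx !orbT.
pose e := E / 2.
have e0 : 0 < e by rewrite divr_gt0.
have EE : E = 2 * e by rewrite /e; field.
have edl : e <= dl.
  by move: Edl dl0 dl1; rewrite EE; clear; nra.
pose v' := s.1 * e * (s.2 * e).
have v'0 : 0 < v' by rewrite !mulr_gt0.
pose K := expR (k0 / (2 * tm)) * Cp * Num.sqrt (2 * pi * tM / a0) / c + (c * v')^-1 * (4 / (h * g)).
exists e, K, (k0 / (h * smin * e)); split.
- by rewrite e0.
- apply: addr_ge0.
    by rewrite divr_ge0 ?(ltW c0)// mulr_ge0 ?sqrtr_ge0// mulr_ge0 ?expR_ge0.
  by rewrite mulr_ge0 ?invr_ge0 ?divr_ge0 ?(ltW hg0) ?(ltW (mulr_gt0 c0 v'0)).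
move=> N n cst C D Cq Dq N0le N0 nN hNn cst0 mCq mDq hC hD H.
have NR0 : 0 < N%:R :> R by rewrite ltr0n.
have nN' : n%:R <= N%:R :> R by rewrite ler_nat.
have n0 : 0 < n%:R :> R by apply: lt_le_trans hNn; exact: mulr_gt0.
have kN : k0 <= h * N%:R * smin * e.
  move: N0le; rewrite ler_pdivrMr ?mulr_gt0//.
  by rewrite (_ : N%:R * _ = h * N%:R * smin * e)//; ring.
have k1 : k0 <= N%:R * s.1 * e.
  apply: (le_trans kN); rewrite ler_pM2r// ler_pM ?(ltW smin0) ?(ltW (mulr_gt0 h0 NR0))//.
  by rewrite -[leRHS]mul1r ler_wpM2r.
have k2 : k0 <= n%:R * s.2 * e.
  apply: (le_trans kN); rewrite ler_pM2r//.
  by rewrite ler_pM ?(ltW smin0) ?(ltW (mulr_gt0 h0 NR0)).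
pose Pk := deviance_at N n s.
pose M := cst * expR (- ((Pk + n%:R * g - 4 * E * N%:R) / 2)).
pose Mp := cst * expR (- ((Pk + 4 * e * N%:R) / 2)).
have Mp0 : 0 < Mp by rewrite mulr_gt0 ?expR_gt0.
have MMp : M / Mp <= 4 / (h * g) / Num.sqrt N%:R.
  rewrite /M /Mp -mulf_div divff ?gt_eqF// mul1r -expRN -expRD.
  apply: (@le_trans _ _ (expR (- (h * g / 4 * N%:R)))).
    rewrite ler_expR.
    have : E * N%:R <= h * g / 12 * N%:R by rewrite ler_wpM2r.
    have : h * N%:R * g <= n%:R * g by rewrite ler_wpM2r// ltW.
    by rewrite EE; clear; lra.
  apply: le_trans (expRN_le_inv_sqrt _ N0) _; first by rewrite divr_gt0.
  rewrite le_eqVlt; apply/orP; left; apply/eqP; field.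
  by rewrite gt_eqF ?sqrtr_gt0// !gt_eqF.
pose b := a0 * N%:R / (2 * tM).
have b0 : 0 < b by rewrite divr_gt0 ?(mulr_gt0 a00 NR0)// mulr_gt0.
have tmM t : box s dl t -> tm <= t.1 <= tM /\ tm <= t.2 <= tM.
  by move=> bt; exact: box_bounds bt.
have boxv : box s dl `<=` @variances R.
  by move=> t /tmM[/andP[t1 _] /andP[t2 _]]; split; exact: lt_le_trans tm0 _.
have mbox : measurable (box s dl : set T2) by rewrite boxE//; exact: measurableX.
have mcorner : measurable (corner s e : set T2) by exact: measurableX.
have cbox : corner s e `<=` box s dl by apply: sub_corner_box => //; exact: ltW.
have := @evidence_le R p (fun th => cst * gauss_lik N n (Cq th.1) (Dq th.1) th.2)
  p0 (fun t => cst * gauss_lik N n C D t) (box s dl) (corner s e)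
  dl (expR (k0 / (2 * tm))) b Cp M c v' Mp dp dp0.
move=> /(_ _ _ _ _ mbox mcorner boxv cbox b0 Cp0 _ _ c0 v'0 Mp0 pC _ _ cp0)/wrap[].
- apply: measurable_funM => //.
  apply: measurable_gauss_lik => //.
  + by apply: measurable_funTS; exact: (measurableT_comp mCq measurable_fst).
  + by apply: measurable_funTS; exact: (measurableT_comp mDq measurable_fst).
  + apply: measurable_funTS; apply: (measurableT_comp measurable_fst).
    exact: measurable_snd.
  + apply: measurable_funTS; apply: (measurableT_comp measurable_snd).
    exact: measurable_snd.
- apply: measurable_funM => //.
  apply: measurable_gauss_lik => //.
  + by apply: measurable_funTS; exact: measurable_fst.
  + by apply: measurable_funTS; exact: measurable_snd.
- by move=> th _; rewrite mulr_ge0 ?expR_ge0 ?ltW.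
- by move=> t _; rewrite mulr_ge0 ?expR_ge0 ?ltW.
- exact: expR_ge0.
- by rewrite mulr_ge0 ?expR_ge0 ?ltW.
- move=> w t wd bt /=; rewrite mulrCA ler_pM2l// /b.
  have [tb1 tb2] := tmM _ bt.
  apply: gauss_lik_near => //.
  + by rewrite mulr_ge0 ?ltW.
  + by case: H => H; [left|right].
- move=> w t vt far /=; rewrite /M ler_pM2l//.
  have aw0 : 0 <= a0 * N%:R * w ^+ 2 by rewrite mulr_ge0 ?sqr_ge0// mulr_ge0 ?ltW.
  apply: (@gauss_lik_far _ _ _ _ _ E dl r) => //.
  + by rewrite (ltW E0).
  + by rewrite (ltW r0).
  + exact: ltW.
  + have [C1 _] := andP hC; have : 0 <= N%:R * s.1 * e by exact: le_trans k1.
    by case: H => /(_ w)[H1 _]; move: C1 H1 k00 k1 aw0; rewrite EE; clear; lra.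
  + have [D1 _] := andP hD; have : 0 <= n%:R * s.2 * e by exact: le_trans k2.
    by case: H => /(_ w)[_ H1]; move: D1 H1 k00 k2 aw0; rewrite EE; clear; lra.
  + have [out1|in1] := ltP dl (`|t.1 / s.1 - 1|); first by constructor 1; exact: ltW.
    have [out2|in2] := ltP dl (`|t.2 / s.2 - 1|); first by constructor 2; exact: ltW.
    have dlw : dl ^+ 2 <= w ^+ 2.
      have dlw : dl < `|w| by rewrite ltNge; apply/negP => wd; apply: far.
      by rewrite -[leRHS]real_normK ?num_real// ler_pXn2r ?nnegrE ?(ltW dlw) ?(ltW dl0).
    have aNdl : a0 * N%:R * dl ^+ 2 <= a0 * N%:R * w ^+ 2.
      by rewrite ler_wpM2l// mulr_ge0 ?ltW.
    case: H => /(_ w)[H1 H2]; [constructor 3|constructor 4].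
      have : N%:R * (s.1 * q) <= N%:R * (a0 * dl ^+ 2 / 2) by rewrite ler_wpM2l.
      have : N%:R * s.1 * r <= N%:R * s.1 * (q / 4) by rewrite ler_wpM2l// mulr_ge0// ltW.
      have : N%:R * s.1 * E <= N%:R * s.1 * (q / 4) by rewrite ler_wpM2l// mulr_ge0// ltW.
      have : 0 <= N%:R * (a0 * dl ^+ 2) by rewrite mulr_ge0// (ltW (mulr_gt0 a00 dl20)).
      by have [C1 _] := andP hC; move: C1 H1 aNdl k1; rewrite EE; clear; lra.
    have : n%:R * (s.2 * q) <= n%:R * (a0 * dl ^+ 2 / 2) by rewrite ler_wpM2l.
    have : n%:R * s.2 * r <= n%:R * s.2 * (q / 4) by rewrite ler_wpM2l// mulr_ge0// ltW.
    have : n%:R * s.2 * E <= n%:R * s.2 * (q / 4) by rewrite ler_wpM2l// mulr_ge0// ltW.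
    have : n%:R * (a0 * dl ^+ 2) <= N%:R * (a0 * dl ^+ 2).
      by rewrite ler_wpM2r// mulr_ge0 ?ltW.
    have : 0 <= N%:R * (a0 * dl ^+ 2) by rewrite mulr_ge0// (ltW (mulr_gt0 a00 dl20)).
    by have [D1 _] := andP hD; move: D1 H2 aNdl k2; rewrite EE; clear; lra.
move=> /(_ _ _)/wrap[].
- by rewrite leb2_corner.
- move=> t [/=]; rewrite !in_itv/= => ct1 ct2.
  have e1 : 0 <= 1 - e by rewrite subr_ge0 (le_trans edl)// ltW.
  rewrite /Mp ler_pM2l//; apply: gauss_lik_peak_le => //.
  + exact: ltW.
  + by case/andP: hC => C1 ->; rewrite andbT (le_trans _ C1)// mulr_ge0// mulr_ge0// ltW.
  + by case/andP: hD => D1 ->; rewrite andbT (le_trans _ D1)// mulr_ge0// mulr_ge0// ltW.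
move=> ev; apply: (le_trans ev); rewrite lee_wpmul2r//.
  apply: integral_ge0 => t vt; case: dp0 => _ p0_ge0 _.
  by rewrite lee_fin mulr_ge0 ?p0_ge0// mulr_ge0 ?expR_ge0// ltW.
rewrite lee_fin /K [leRHS]mulrDl; apply: lerD.
  rewrite le_eqVlt; apply/orP; left; apply/eqP.
  have -> : pi / b = (2 * pi * tM / a0) * N%:R^-1.
    by rewrite /b; field; rewrite !gt_eqF.
  rewrite sqrtrM; last by rewrite divr_ge0 ?(ltW a00)// mulr_ge0 ?(ltW tM0)// mulr_ge0// pi_ge0.
  by rewrite sqrtrV//; ring.
have -> : M / (c * v' * Mp) = (c * v')^-1 * (M / Mp) by field; rewrite !gt_eqF.
by rewrite -[leRHS]mulrA ler_wpM2l// invr_ge0 mulr_ge0// ltW.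
Qed.

End evidence_ratio.

(** * Moments of the samples *)

Section sample_moments.
Context d (T : measurableType d) (R : realType) (P : probability T R).

Lemma mutually_independent_pair d' (T' : measurableType d') (I : finType)
    (X : I -> {RV P >-> T'}) (a b : I) (A B : set T') :
  mutually_independent X -> a != b -> measurable A -> measurable B ->
  P (X a @^-1` A `&` X b @^-1` B) = (P (X a @^-1` A) * P (X b @^-1` B))%E.
Proof.
move=> indep ab mA mB.
have := indep [set a; b]%SET (fun k => if k == a then A else B).
rewrite big_setU1/= ?inE// big_set1 eqxx (negbTE (_ : b != a)) 1?eq_sym// => <-.
- congr (P _); apply/seteqP; split => o /=.
  + by move=> [Ao Bo] k; rewrite !inE => /orP[]/eqP->; rewrite ?eqxx// eq_sym (negbTE ab).
  + move=> H; split; first by have := H a; rewrite !inE eqxx; exact.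
    by have := H b; rewrite !inE eqxx orbT eq_sym (negbTE ab); exact.
- by move=> k; case: ifP.
Qed.

Lemma normal_rv_moments (Z : T -> R) (s : R) : 0 < s ->
  measurable_fun setT Z ->
  (forall A : set R, measurable A -> P (Z @^-1` A) = normal_prob 0 s A) ->
  [/\ (\int[P]_o (Z o)%:E = 0)%E, (\int[P]_o (Z o ^+ 2)%:E = (s ^+ 2)%:E)%E &
      (\int[P]_o (Z o ^+ 4)%:E = \int[normal_prob 0 s]_x (x ^+ 4)%:E)%E].
Proof.
move=> s0 mZ law.
(* The normal law lives on the Borel type attached to R, so Z has to be regarded
   as a map into that type before its image measure can be compared with it. *)
pose Z' : T -> measurableTypeR R := Z.
have mZ' : measurable_fun setT Z' by exact: mZ.
have ge0 (f : measurableTypeR R -> \bar R) : measurable_fun setT f ->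
    (forall x, 0 <= f x)%E -> (\int[P]_o f (Z' o) = \int[normal_prob 0 s]_x f x)%E.
  move=> mf f0; transitivity (\int[pushforward P Z']_x f x)%E.
    by rewrite ge0_integral_pushforward// preimage_setT.
  by apply: eq_measure_integral => A mA _; exact: law.
have m2 : (\int[P]_o (Z o ^+ 2)%:E = (s ^+ 2)%:E)%E.
  rewrite (ge0 (fun x => (x ^+ 2)%:E)) ?normal_second_moment//.
  - by apply/measurable_EFinP; exact: measurable_funX.
  - by move=> x; rewrite lee_fin sqr_ge0.
split => //.
- rewrite -(normal_mean s0).
  transitivity (\int[pushforward P Z']_x x%:E)%E.
    rewrite integral_pushforward// ?preimage_setT//.
    by apply: integrable_of_sqr => //; rewrite m2 ltry.
  by apply: eq_measure_integral => A mA _; exact: law.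
- rewrite (ge0 (fun x => (x ^+ 4)%:E))//.
  - by apply/measurable_EFinP; exact: measurable_funX.
  - by move=> x; rewrite lee_fin exprn_even_ge0.
Qed.

Definition normal_fourth_moment (t : R) : R :=
  fine (\int[normal_prob 0 (Num.sqrt t)]_x (x ^+ 4)%:E)%E.

Lemma normal_rv_fourth_moment (Z : T -> R) (t : R) : 0 < t ->
  measurable_fun setT Z ->
  (forall A : set R, measurable A -> P (Z @^-1` A) = normal_prob 0 (Num.sqrt t) A) ->
  (\int[P]_o (Z o ^+ 4)%:E = (normal_fourth_moment t)%:E)%E.
Proof.
move=> t0 mZ law; have st0 : 0 < Num.sqrt t by rewrite sqrtr_gt0.
have [_ _ ->] := normal_rv_moments st0 mZ law.
rewrite /normal_fourth_moment fineK// ge0_fin_numE ?normal_fourth_moment_lty//.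
by apply: integral_ge0 => x _; rewrite lee_fin exprn_even_ge0.
Qed.

Lemma centered_square_moments (Z : T -> R) (t : R) : 0 < t ->
  measurable_fun setT Z ->
  (forall A : set R, measurable A -> P (Z @^-1` A) = normal_prob 0 (Num.sqrt t) A) ->
  (\int[P]_o (Z o ^+ 2 - t)%:E = 0)%E /\
  (\int[P]_o ((Z o ^+ 2 - t) ^+ 2)%:E <= (normal_fourth_moment t + t ^+ 2)%:E)%E.
Proof.
move=> t0 mZ law; have st0 : 0 < Num.sqrt t by rewrite sqrtr_gt0.
have [m1 m2 _] := normal_rv_moments st0 mZ law.
have m4 := normal_rv_fourth_moment t0 mZ law.
have mZ2 : measurable_fun setT (fun o => Z o ^+ 2) by exact: measurable_funX.
split.
  under eq_integral do rewrite EFinB.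
  rewrite integralB_EFin//.
  - by rewrite m2 sqr_sqrtr ?ltW// integral_cst//= probability_setT mule1 subee.
  - apply: integrable_of_sqr => //.
    by under eq_integral do rewrite -exprM; rewrite m4 ltry.
  - exact: finite_measure_integrable_cst.
apply: (@le_trans _ _ (\int[P]_o ((Z o ^+ 4)%:E + (t ^+ 2)%:E)))%E.
  apply: ge0_le_integral => //.
  - by move=> o _; rewrite lee_fin sqr_ge0.
  - by apply/measurable_EFinP; apply: measurable_funX; exact: measurable_funB.
  - by apply/measurable_EFinP/measurable_funD => //; exact: measurable_funX.
  - move=> o _; rewrite -EFinD lee_fin.
    have : 0 <= t * Z o ^+ 2 by rewrite mulr_ge0 ?sqr_ge0// ltW.
    by rewrite (_ : Z o ^+ 4 = (Z o ^+ 2) ^+ 2) -?exprM//; lra.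
rewrite ge0_integralD//.
- by rewrite m4 integral_cst//= probability_setT mule1 EFinD.
- by move=> o _; rewrite lee_fin exprn_even_ge0.
- by apply/measurable_EFinP; exact: measurable_funX.
- by move=> o _; rewrite lee_fin sqr_ge0.
Qed.

(** Under the independence structure the product of the two coordinates is
    centred; its square is at most the sum of the fourth powers. *)
Lemma product_moments (Z1 Z2 : T -> R) (t1 t2 : R) : 0 < t1 -> 0 < t2 ->
  measurable_fun setT Z1 -> measurable_fun setT Z2 ->
  (forall A B : set R, measurable A -> measurable B ->
     P (Z1 @^-1` A `&` Z2 @^-1` B) =
     (normal_prob 0 (Num.sqrt t1) A * normal_prob 0 (Num.sqrt t2) B)%E) ->
  [/\ forall A : set R, measurable A -> P (Z1 @^-1` A) = normal_prob 0 (Num.sqrt t1) A,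
      forall A : set R, measurable A -> P (Z2 @^-1` A) = normal_prob 0 (Num.sqrt t2) A,
      (\int[P]_o (Z1 o * Z2 o)%:E = 0)%E &
      (\int[P]_o ((Z1 o * Z2 o) ^+ 2)%:E <= (normal_fourth_moment t1 + normal_fourth_moment t2)%:E)%E].
Proof.
move=> t10 t20 mZ1 mZ2 law.
have law1 (A : set R) : measurable A -> P (Z1 @^-1` A) = normal_prob 0 (Num.sqrt t1) A.
  move=> mA; have := law A setT mA measurableT.
  by rewrite preimage_setT setIT probability_setT mule1.
have law2 (A : set R) : measurable A -> P (Z2 @^-1` A) = normal_prob 0 (Num.sqrt t2) A.
  move=> mA; have := law setT A measurableT mA.
  by rewrite preimage_setT setTI probability_setT mul1e.
have s1 : 0 < Num.sqrt t1 by rewrite sqrtr_gt0.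
have s2 : 0 < Num.sqrt t2 by rewrite sqrtr_gt0.
have [_ E1 _] := normal_rv_moments s1 mZ1 law1.
have [E0 E2 _] := normal_rv_moments s2 mZ2 law2.
split => //.
  pose Z1' : {RV P >-> R} := HB.pack Z1 (isMeasurableFun.Build _ _ _ _ _ mZ1).
  pose Z2' : {RV P >-> R} := HB.pack Z2 (isMeasurableFun.Build _ _ _ _ _ mZ2).
  apply: (@integral_mul_independent _ _ _ P Z1' Z2') => //=.
  - by move=> A B mA mB; rewrite law// law1// law2.
  - by rewrite E1 ltry.
  - by rewrite E2 ltry.
apply: (@le_trans _ _ (\int[P]_o ((Z1 o ^+ 4)%:E + (Z2 o ^+ 4)%:E)))%E.
  apply: ge0_le_integral => //.
  - by move=> o _; rewrite lee_fin sqr_ge0.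
  - by apply/measurable_EFinP; apply: measurable_funX; exact: measurable_funM.
  - by apply/measurable_EFinP/measurable_funD; exact: measurable_funX.
  - move=> o _; rewrite -EFinD lee_fin exprMn.
    rewrite (_ : Z1 o ^+ 4 = (Z1 o ^+ 2) ^+ 2) -?exprM//.
    rewrite (_ : Z2 o ^+ 4 = (Z2 o ^+ 2) ^+ 2) -?exprM//.
    have := sqr_ge0 (Z1 o ^+ 2 - Z2 o ^+ 2); nra.
rewrite ge0_integralD//.
- by rewrite (normal_rv_fourth_moment t10 mZ1 law1) (normal_rv_fourth_moment t20 mZ2 law2) EFinD.
- by move=> o _; rewrite lee_fin exprn_even_ge0.
- by apply/measurable_EFinP; exact: measurable_funX.
- by move=> o _; rewrite lee_fin exprn_even_ge0.
- by apply/measurable_EFinP; exact: measurable_funX.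
Qed.

Lemma chebyshev_iid_sum d' (T' : measurableType d') (I : finType)
    (X : I -> {RV P >-> T'}) (n : nat) (k : 'I_n -> I) (f : T' -> R) (v a : R) :
  mutually_independent X -> injective k -> measurable_fun setT f ->
  (forall i, \int[P]_o (f (X (k i) o))%:E = 0)%E ->
  (forall i, \int[P]_o (f (X (k i) o) ^+ 2)%:E <= v%:E)%E ->
  0 < a ->
  (P [set o | (a <= `|\sum_(i < n) f (X (k i) o)|)%R] <= (n%:R * v / a ^+ 2)%R%:E)%E.
Proof.
move=> indep kinj mf f1 f2 a0.
have mW i : measurable_fun setT (fun o => f (X (k i) o)) by exact: measurableT_comp.
pose W i : {RV P >-> R} := HB.pack (fun o => f (X (k i) o)) (isMeasurableFun.Build _ _ _ _ _ (mW i)).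
apply: (@chebyshev_pairwise_independent _ _ _ P n W v a) => // i j ij A B mA mB.
have := @mutually_independent_pair _ _ _ X (k i) (k j) (f @^-1` A) (f @^-1` B) indep.
apply.
- by apply: contra ij => /eqP/kinj->.
- by rewrite -[X in measurable X]setTI; exact: mf.
- by rewrite -[X in measurable X]setTI; exact: mf.
Qed.

End sample_moments.

(** * Priors near the truth, and measurability of the posterior *)

Section priors_near_truth.
Context {R : realType}.

Lemma box_mono (s : R * R) (a b : R) : a <= b -> box s a `<=` box s b.
Proof. by move=> ab t [h1 h2]; split; exact: le_trans ab. Qed.

(** [box] measures relative errors and [ball] absolute ones; the factor
    1 + s.1 + s.2 converts between them for both coordinates at once. *)
Lemma box_ball (s : R * R) (r : R) : variances s -> 0 < r ->
  exists2 dl : R, 0 < dl < r & box s dl `<=` ball s r.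
Proof.
move=> [s1 s2] r0.
have s12 : 0 < 1 + s.1 + s.2 by rewrite addr_gt0// addr_gt0.
exists (r / 2 / (1 + s.1 + s.2)).
  rewrite !divr_gt0//= ltr_pdivrMr// ltr_pdivrMr//; nra.
set dl := r / 2 / _.
have dlr : dl * (1 + s.1 + s.2) = r / 2 by rewrite divfK// gt_eqF.
have dl0 : 0 < dl by rewrite !divr_gt0.
move=> t [h1 h2]; split; rewrite /= /ball/= distrC.
  have -> : t.1 - s.1 = (t.1 / s.1 - 1) * s.1 by field; rewrite gt_eqF.
  rewrite normrM (gtr0_norm s1); have := ler_wpM2r (ltW s1) h1; nra.
have -> : t.2 - s.2 = (t.2 / s.2 - 1) * s.2 by field; rewrite gt_eqF.
rewrite normrM (gtr0_norm s2); have := ler_wpM2r (ltW s2) h2; nra.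
Qed.

Lemma prior_le_near (p : R * (R * R) -> R) (s : R * R) :
  variances s -> {for (0, s), continuous p} ->
  exists2 dl : R, 0 < dl & forall w t, `|w| <= dl -> box s dl t ->
    p (w, t) <= p (0, s) + 1.
Proof.
move=> vs /(_ _ (nbhsx_ballx (p (0, s)) 1 ltr01)).
move=> /nbhs_ballP[r /= r0 H].
have [dl /andP[dl0 dlr] bdl] := box_ball vs r0.
exists dl => // w t wd bt.
have /H : ball ((0 : R), s) r (w, t).
  split => /=; last exact: bdl.
  by rewrite /ball/= sub0r normrN (le_lt_trans wd).
by rewrite /= /ball/= ltr_norml => /andP[h _]; lra.
Qed.

Lemma prior_ge_near (p : R * R -> R) (s : R * R) :
  variances s -> {for s, continuous p} -> 0 < p s ->
  exists2 dl : R, 0 < dl & forall t, box s dl t -> p s / 2 <= p t.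
Proof.
move=> vs cp ps0; have ps20 : 0 < p s / 2 by rewrite divr_gt0.
move: cp => /(_ _ (nbhsx_ballx (p s) _ ps20)).
move=> /nbhs_ballP[r /= r0 H].
have [dl /andP[dl0 dlr] bdl] := box_ball vs r0.
exists dl => // t /bdl/H.
by rewrite /= /ball/= ltr_norml => /andP[_ h]; lra.
Qed.

End priors_near_truth.

(** Needed for the measurability part of Tonelli's theorem, with the sample as
    parameter of an integral over [Theta]. *)
Lemma leb3_sigma_finite (R : realType) : sigma_finite setT (@leb3 R).
Proof.
have /sigma_finiteP[F [TF ndF Foo]] := sigma_finiteT (@lebesgue_measure R).
have /sigma_finiteP[G [TG ndG Goo]] := sigma_finiteT (@leb2 R).
exists (fun n => F n `*` G n).
  rewrite -setXTT TF TG predeqE => -[x t]; split.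
    move=> [/= [n _ Fnx] [k _ Gkt]]; exists (maxn n k) => //; split.
    - by move: x Fnx; exact/subsetPset/ndF/leq_maxl.
    - by move: t Gkt; exact/subsetPset/ndG/leq_maxr.
  by move=> [n _ []/= ? ?]; split; exists n.
move=> k; have [? ?] := Foo k; have [? ?] := Goo k.
split; first exact: measurableX.
by rewrite /leb3 product_measure1E// lte_mul_pinfty// ge0_fin_numE.
Qed.

HB.instance Definition _ (R : realType) :=
  Measure_isSigmaFinite.Build _ _ _ (@leb3 R) (@leb3_sigma_finite R).

Section posterior_measurable.
Context d (T : measurableType d) (R : realType).
Local Notation T2 := (measurableTypeR R * measurableTypeR R)%type.
Local Notation T3 := (measurableTypeR R * T2)%type.

(** Extending f by 0 outside D makes it measurable on the whole product, where
    Tonelli's theorem gives the measurability of its partial integrals. *)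
Lemma measurable_integral_param d2 (U : measurableType d2)
    (mu : {sigma_finite_measure set U -> \bar R}) (D : set U) (f : T * U -> R) :
  measurable D -> measurable_fun (setT `*` D) f ->
  (forall x z, D z -> 0 <= f (x, z)) ->
  measurable_fun setT (fun x => \int[mu]_(z in D) (f (x, z))%:E)%E.
Proof.
move=> mD mf f0.
have mTD : measurable ([set: T] `*` D) by exact: measurableX.
pose g := (fun xz => (f xz)%:E) \_ (setT `*` D).
have mg : measurable_fun setT g.
  by apply/(measurable_restrictT _ _).1 => //; exact/measurable_EFinP.
have g0 xz : (0 <= g xz)%E.
  rewrite /g patchE; case: ifPn => //; rewrite inE => -[_ Dz].
  by case: xz Dz => x z Dz; rewrite lee_fin f0.
have := measurable_fun_fubini_tonelli_F (m2 := mu) g mg g0.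
rewrite (_ : fubini_F mu g = (fun x => \int[mu]_(z in D) (f (x, z))%:E)%E)//.
apply/funext => x; rewrite /fubini_F [RHS]integral_mkcond; apply: eq_integral => z _.
rewrite /g !patchE; congr (if _ then _ else _).
by apply/idP/idP; rewrite !inE => //= -[].
Qed.

Context (y : R) (n m : nat)
  (xs : 'I_n -> T -> R * R) (ys : 'I_m -> T -> R * R) (pi : priors R)
  (mxs : forall i, measurable_fun setT (xs i))
  (mys : forall j, measurable_fun setT (ys j))
  (dens1 : is_density (@leb3 R) (@Theta R) (prior1 pi))
  (dens2 : is_density (@leb3 R) (@Theta R) (prior2 pi))
  (dens3 : is_density (@leb2 R) (@variances R) (prior3 pi)).

Lemma measurable_likelihood d2 (U : measurableType d2) (D : set U) S
    (w : U -> R) (t : U -> R * R) :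
  measurable D ->
  measurable_fun D w -> measurable_fun D (fun z => (t z).1) ->
  measurable_fun D (fun z => (t z).2) -> (forall z, D z -> variances (t z)) ->
  measurable_fun (setT `*` D) (fun oz : T * U =>
    likelihood y (xs^~ oz.1) (ys^~ oz.1) S (w oz.2, t oz.2)).
Proof.
move=> mD mw mt1 mt2 Dv.
have mTD : measurable ([set: T] `*` D) by exact: measurableX.
have comp (g : U -> R) : measurable_fun D g ->
    measurable_fun (setT `*` D) (fun oz : T * U => g oz.2).
  move=> mg; apply: (measurable_comp mD) => //.
    by move=> _ [oz [_ Dz] <-].
  exact: measurable_funTS measurable_snd.
have mcw : measurable_fun (setT `*` D) (fun oz : T * U => slope1 S (w oz.2)).
  by case: (S) => //=; exact: comp.
have mcw2 : measurable_fun (setT `*` D) (fun oz : T * U => slope2 S (w oz.2)).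
  by case: (S) => //=; exact: comp.
have mx i : measurable_fun (setT `*` D) (fun oz : T * U => xs i oz.1).
  by apply: measurable_funTS; exact: measurableT_comp measurable_fst.
have my j : measurable_fun (setT `*` D) (fun oz : T * U => ys j oz.1).
  by apply: measurable_funTS; exact: measurableT_comp measurable_fst.
apply: (eq_measurable_fun (fun oz : T * U => normal_peak 1 ^+ (n + m + n) *
    gauss_lik (n + m) n (resid1 y (xs^~ oz.1) (ys^~ oz.1) (slope1 S (w oz.2)))
      (resid2 (xs^~ oz.1) (slope2 S (w oz.2))) (t oz.2))).
  by move=> oz; rewrite inE => -[_ Dz]; rewrite likelihoodE//; exact: Dv.
apply: measurable_funM => //; apply: measurable_gauss_lik.
- by move=> oz [_ Dz]; exact: Dv.
- exact: (measurable_resid1 y mx my mcw).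
- exact: (measurable_resid2 mx mcw2).
- exact: (comp (fun z => (t z).1)).
- exact: (comp (fun z => (t z).2)).
Qed.

Lemma likelihood_ge0 n' m' (xs' : 'I_n' -> R * R) (ys' : 'I_m' -> R * R) S th :
  0 <= likelihood y xs' ys' S th.
Proof.
rewrite mulr_ge0// prodr_ge0// => i _; rewrite /int_pdf ?normal_pdf_ge0//.
by case: th => w [t1 t2]; case: S; rewrite /= mulr_ge0// normal_pdf_ge0.
Qed.

Lemma measurable_evidence S :
  measurable_fun setT (fun o => evidence pi y (xs^~ o) (ys^~ o) S).
Proof.
have mTh := @measurable_Theta R; have mva := @measurable_variances R.
have snd2 (p : T3 -> R) : measurable_fun (@Theta R) p ->
    measurable_fun (setT `*` @Theta R) (fun oz : T * T3 => p oz.2).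
  move=> mp; apply: (measurable_comp mTh) => //.
    by move=> _ [oz [_ Dz] <-].
  by apply: measurable_funTS measurable_snd; exact: measurableX.
have step S' (p : T3 -> R) : is_density (@leb3 R) (@Theta R) p ->
  measurable_fun setT (fun o => \int[@leb3 R]_(th in @Theta R)
    (likelihood y (xs^~ o) (ys^~ o) S' th * p th)%:E)%E.
  move=> [mp p0 _].
  apply: (@measurable_integral_param _ T3 (@leb3 R) (@Theta R)
    (fun oz : T * T3 => likelihood y (xs^~ oz.1) (ys^~ oz.1) S' oz.2 * p oz.2)) => //.
    apply: measurable_funM; last exact: snd2.
    apply: (eq_measurable_fun (fun oz : T * T3 => likelihood y (xs^~ oz.1) (ys^~ oz.1) S' (oz.2.1, oz.2.2))).
      by move=> [u [w t]].
    apply: (@measurable_likelihood _ T3 (@Theta R) S' (fun th => th.1) (fun th => th.2)) => //.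
    - by apply: measurable_funTS; exact: measurable_fst.
    - by apply: measurable_funTS; exact: measurableT_comp measurable_snd.
    - by apply: measurable_funTS; exact: measurableT_comp measurable_snd.
  by move=> o th Tth /=; rewrite mulr_ge0 ?likelihood_ge0 ?p0.
case: S; [exact: step dens1|exact: step dens2|].
case: dens3 => mp p0 _.
apply: (@measurable_integral_param _ T2 (@leb2 R) (@variances R)
    (fun oz : T * T2 => likelihood y (xs^~ oz.1) (ys^~ oz.1) S3 (0, oz.2) * prior3 pi oz.2)) => //.
  apply: measurable_funM; last first.
    apply: (measurable_comp mva) => //.
      by move=> _ [oz [_ Dz] <-].
    by apply: measurable_funTS measurable_snd; exact: measurableX.
  apply: (@measurable_likelihood _ T2 (@variances R) S3 (fun=> 0) (fun t => t)) => //.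
  - by apply: measurable_funTS; exact: measurable_fst.
  - by apply: measurable_funTS; exact: measurable_snd.
by move=> o t vt /=; rewrite mulr_ge0 ?likelihood_ge0 ?p0.
Qed.

Lemma evidence_ge0 n' m' (xs' : 'I_n' -> R * R) (ys' : 'I_m' -> R * R) S :
  (0 <= evidence pi y xs' ys' S)%E.
Proof.
case: S; apply: integral_ge0 => th Tth; rewrite lee_fin mulr_ge0 ?likelihood_ge0//.
- by case: dens1 => _ /(_ th Tth).
- by case: dens2 => _ /(_ th Tth).
- by case: dens3 => _ /(_ th Tth).
Qed.

(** The denominator is a sum of nonnegative reals, so the inverse in the
    posterior is a power -1, which is measurable even at 0. *)
Lemma measurable_posterior S :
  measurable_fun setT (fun o => posterior pi y (xs^~ o) (ys^~ o) S).
Proof.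
pose ev S' (o : T) : R := fine (evidence pi y (xs^~ o) (ys^~ o) S').
have mev S' : measurable_fun setT (ev S').
  exact: (measurableT_comp (fine_measurable measurableT) (measurable_evidence S')).
have ev0 S' o : 0 <= ev S' o by rewrite fine_ge0// evidence_ge0.
apply: (eq_measurable_fun (fun o => ev S o * (ev S1 o + ev S2 o + ev S3 o) `^ (- 1))).
  by move=> o _; rewrite powR_inv1// !addr_ge0.
apply: measurable_funM => //.
apply: (measurableT_comp (measurable_powR (- 1))).
by do 2 apply: measurable_funD => //.
Qed.

End posterior_measurable.

(** * The posterior on samples with typical moments *)

Section posterior_bound.
Context {R : realType}.
Local Notation T2 := (measurableTypeR R * measurableTypeR R)%type.
Local Notation T3 := (measurableTypeR R * T2)%type.

(** The finiteness of the evidence of S3 passes to the other two, so that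
    [fine] loses nothing. *)
Lemma posterior_error_le (pi : priors R) (y : R) (n m : nat)
    (xs : 'I_n -> R * R) (ys : 'I_m -> R * R) (k1 k2 : R) :
  let ev := evidence pi y xs ys in
  (0 <= ev S1)%E -> (0 <= ev S2)%E -> (0 < ev S3 < +oo)%E ->
  (ev S1 <= k1%:E * ev S3)%E -> (ev S2 <= k2%:E * ev S3)%E ->
  `|1 - posterior pi y xs ys S3| <= k1 + k2.
Proof.
rewrite /posterior; move: (evidence pi y xs ys) => ev /= ev1 ev2 /andP[ev30 ev3oo] h1 h2.
have f3 : ev S3 \is a fin_num by rewrite ge0_fin_numE// ltW.
have fin k S : (0 <= ev S)%E -> (ev S <= k%:E * ev S3)%E -> ev S \is a fin_num.
  by move=> S0 Sk; rewrite ge0_fin_numE// (le_lt_trans Sk)// -(fineK f3) -EFinM ltry.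
have f1 := fin _ _ ev1 h1; have f2 := fin _ _ ev2 h2.
move: ev1 ev2 ev30 h1 h2; rewrite -(fineK f1) -(fineK f2) -(fineK f3) -!EFinM.
rewrite !lee_fin lte_fin !fineK//=.
set a := fine (ev S1); set b := fine (ev S2); set c := fine (ev S3).
move=> a0 b0 c0 ak bk.
have ab0 : 0 <= a + b by exact: addr_ge0.
have abc : 0 < a + b + c by exact: ltr_wpDl.
have -> : 1 - c / (a + b + c) = (a + b) / (a + b + c) by field; rewrite gt_eqF.
rewrite ger0_norm; last by rewrite divr_ge0// ltW.
rewrite ler_pdivrMr//.
have k12 : 0 <= k1 + k2.
  have : 0 <= (k1 + k2) * c by rewrite mulrDl; lra.
  by rewrite pmulr_lge0.
have : 0 <= (k1 + k2) * (a + b) by exact: mulr_ge0.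
lra.
Qed.

(** Finite because the likelihood is bounded, positive because both the
    likelihood and the prior are bounded below on a corner at s. *)
Lemma gauss_lik_evidence_pos_fin (p0 : T2 -> R) (s : R * R) (c e : R) (N n : nat) (cst C D : R) :
  is_density (@leb2 R) (@variances R) p0 -> variances s -> 0 < e <= 2^-1 ->
  0 < c -> (forall t, corner s e t -> c <= p0 t) -> (n <= N)%N -> 0 < cst ->
  N%:R * s.1 * (1 - e) <= C <= N%:R * s.1 * (1 + e) ->
  n%:R * s.2 * (1 - e) <= D <= n%:R * s.2 * (1 + e) ->
  (0 < \int[@leb2 R]_(t in @variances R) (cst * gauss_lik N n C D t * p0 t)%:E < +oo)%E.
Proof.
move=> dp0 vs /andP[e0 e2] c0 cp0 nN cst0 /andP[C1 C2] /andP[D1 D2].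
have [s1 s2] := vs.
have mL : measurable_fun (@variances R : set T2) (fun t : T2 => cst * gauss_lik N n C D t).
  apply: measurable_funM => //; apply: measurable_gauss_lik => //.
  + by apply: measurable_funTS; exact: measurable_fst.
  + by apply: measurable_funTS; exact: measurable_snd.
have e1 : 0 <= 1 - e by lra.
apply/andP; split; last first.
  apply: (@evidence_lty _ _ _ (cst * expR (- ((deviance_at N n s - 4 * e * N%:R) / 2)))) => //.
  - move=> t vt; rewrite mulr_ge0 ?expR_ge0 ?(ltW cst0)//= ler_pM2l//.
    by apply: gauss_lik_le => //; rewrite (ltW e0).
  - by rewrite mulr_ge0 ?expR_ge0 ?(ltW cst0).
pose M1 := cst * expR (- ((deviance_at N n s + 4 * e * N%:R) / 2)).
have M10 : 0 < M1 by rewrite mulr_gt0 ?expR_gt0.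
pose v' := s.1 * e * (s.2 * e).
have v'0 : 0 < v' by rewrite !mulr_gt0.
have Cge0 : 0 <= C by rewrite (le_trans _ C1)// mulr_ge0// mulr_ge0// ltW.
have Dge0 : 0 <= D by rewrite (le_trans _ D1)// mulr_ge0// mulr_ge0// ltW.
case: dp0 => mp0 p0_ge0 _.
have sub : corner s e `<=` @variances R.
  move=> t [/=]; rewrite !in_itv/= => /andP[t1 _] /andP[t2 _].
  by split; [exact: lt_le_trans t1|exact: lt_le_trans t2].
have mcorner : measurable (corner s e : set T2) by exact: measurableX.
apply: (@lt_le_trans _ _ (c * v' * M1)%:E).
  by rewrite lte_fin; exact: mulr_gt0 (mulr_gt0 c0 v'0) M10.
apply: (@evidence_ge _ (fun t => cst * gauss_lik N n C D t) p0 (corner s e)) => //.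
- by move=> t _; rewrite mulr_ge0 ?expR_ge0 ?(ltW cst0).
- move=> t [/=]; rewrite !in_itv/= => ct1 ct2.
  rewrite /M1 ler_pM2l//; apply: gauss_lik_peak_le => //.
  + exact: ltW.
  + by rewrite Cge0.
  + by rewrite Dge0.
- by rewrite leb2_corner.
Qed.

Lemma sqr_le_of_norm (x b : R) : `|x| <= b -> x ^+ 2 <= b ^+ 2.
Proof.
move=> xb; rewrite -[leLHS]real_normK ?num_real// ler_pXn2r ?nnegrE//.
exact: le_trans xb.
Qed.

(** The deterministic half of the theorem: on every large sample with typical
    empirical means, the posterior mass outside S3 is at most K / sqrt N.
    The cross terms only have to be O(sqrt N), with a constant kap as large as
    desired; enlarging it enlarges K and N0. *)
Lemma posterior_bound (pi : priors R) (y h kap : R) (s : R * R) :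
  is_density (@leb3 R) (@Theta R) (prior1 pi) ->
  is_density (@leb3 R) (@Theta R) (prior2 pi) ->
  is_density (@leb2 R) (@variances R) (prior3 pi) ->
  {for (0, s), continuous (prior1 pi)} ->
  {for (0, s), continuous (prior2 pi)} ->
  {for s, continuous (prior3 pi)} ->
  variances s -> 0 < prior3 pi s -> 0 < h <= 1 ->
  exists eps K N0 : R, [/\ 0 < eps, 0 <= K &
   forall (n m : nat) (xs : 'I_n -> R * R) (ys : 'I_m -> R * R),
    N0 <= (n + m)%:R -> (0 < n + m)%N -> h * (n + m)%:R <= n%:R ->
    `|\sum_(i < n) ((xs i).1 ^+ 2 - s.1)| <= eps * (n + m)%:R ->
    `|\sum_(i < n) ((xs i).2 ^+ 2 - s.2)| <= eps * (n + m)%:R ->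
    `|\sum_(j < m) ((ys j).1 ^+ 2 - s.1)| <= eps * (n + m)%:R ->
    `|\sum_(i < n) ((xs i).1 * (xs i).2)| <= kap * Num.sqrt (n + m)%:R ->
    `|\sum_(j < m) (y * (ys j).1)| <= kap * Num.sqrt (n + m)%:R ->
    `|1 - posterior pi y xs ys S3| <= K / Num.sqrt (n + m)%:R].
Proof.
move=> dens1 dens2 dens3 c1 c2 c3 vs p30 /andP[h0 h1].
have [s1 s2] := vs.
have Ts : Theta (0 : R, s) by [].
have [dl1 dl10 hdl1] := prior_le_near vs c1.
have [dl2 dl20 hdl2] := prior_le_near vs c2.
have [dl3 dl30 hdl3] := prior_ge_near vs c3 p30.
pose dl := Num.min (Num.min dl1 dl2) (Num.min dl3 2^-1).
have dl0 : 0 < dl by rewrite !lt_min dl10 dl20 dl30/= invr_gt0.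
have dll1 : dl <= dl1 by rewrite !ge_min lexx.
have dll2 : dl <= dl2 by rewrite !ge_min lexx orbT.
have dll3 : dl <= dl3 by rewrite !ge_min lexx !orbT.
have dlh : dl <= 2^-1 by rewrite !ge_min lexx !orbT.
have dllt1 : dl < 1 by rewrite (le_lt_trans dlh)// invf_lt1// ltr1n.
have dl01 : 0 < dl < 1 by rewrite dl0.
pose tmin := Num.min s.1 s.2.
have tmin0 : 0 < tmin by rewrite lt_min s1 s2.
have tmin1 : tmin <= s.1 by rewrite ge_min lexx.
have tmin2 : tmin <= s.2 by rewrite ge_min lexx orbT.
have ht0 : 0 < h * tmin by rewrite mulr_gt0.
(* Typical samples have curvature A >= h tmin N / 2, of which [quadratic_ge]
   keeps one half, and cross term B^2 <= 4 kap^2 N; k0 is then the gain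
   2 B^2 / A left to the slope. *)
pose a0 := h * tmin / 4.
have a00 : 0 < a0 by rewrite divr_gt0.
pose k0 := 16 * kap ^+ 2 / (h * tmin).
have k00 : 0 <= k0 by rewrite divr_ge0 ?(ltW ht0)// mulr_ge0 ?sqr_ge0.
have h01 : 0 < h <= 1 by rewrite h0.
have c0 : 0 < prior3 pi s / 2 by rewrite divr_gt0.
have cp3 t : box s dl t -> prior3 pi s / 2 <= prior3 pi t.
  by move=> bt; apply: hdl3; exact: box_mono bt.
have Cp10 : 0 <= prior1 pi (0, s) + 1.
  by case: dens1 => _ /(_ _ Ts) p0 _; rewrite addr_ge0.
have Cp20 : 0 <= prior2 pi (0, s) + 1.
  by case: dens2 => _ /(_ _ Ts) p0 _; rewrite addr_ge0.
have pC1 w t : `|w| <= dl -> box s dl t -> prior1 pi (w, t) <= prior1 pi (0, s) + 1.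
  by move=> wd bt; apply: hdl1; [exact: le_trans dll1|exact: box_mono bt].
have pC2 w t : `|w| <= dl -> box s dl t -> prior2 pi (w, t) <= prior2 pi (0, s) + 1.
  by move=> wd bt; apply: hdl2; [exact: le_trans dll2|exact: box_mono bt].
have [e1 [K1 [N1 [/andP[e10 e1dl] K10 H1]]]] :=
  gauss_lik_evidence_ratio dens1 dens3 vs dl01 Cp10 c0 h01 a00 k00 pC1 cp3.
have [e2 [K2 [N2 [/andP[e20 e2dl] K20 H2]]]] :=
  gauss_lik_evidence_ratio dens2 dens3 vs dl01 Cp20 c0 h01 a00 k00 pC2 cp3.
pose e := Num.min e1 e2.
have e0 : 0 < e by rewrite lt_min e10.
have ee1 : e <= e1 by rewrite ge_min lexx.
have ee2 : e <= e2 by rewrite ge_min lexx orbT.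
(* The sum of squares of all first coordinates collects two errors eps N, and
   must be within N s.1 e of its expectation; the second coordinates have only
   n >= h N terms.  Both requirements hold with this eps. *)
exists (h * tmin * e / 2), (K1 + K2), (Num.max N1 N2); split.
- by rewrite divr_gt0// mulr_gt0.
- by rewrite addr_ge0.
move=> n m xs ys; set N := (n + m)%N => N0 Npos hNn hx1 hx2 hy1 hxy hyy.
have NR0 : 0 < N%:R :> R by rewrite ltr0n.
have nN : (n <= N)%N by rewrite leq_addr.
have mE : m%:R = N%:R - n%:R :> R by rewrite /N natrD; ring.
pose cst : R := normal_peak 1 ^+ (n + m + n).
have cst0 : 0 < cst by rewrite exprn_gt0// normal_peak_gt0// oner_neq0.
pose C := resid1 y xs ys 0; pose D := resid2 xs 0.
pose sx1 := \sum_(i < n) (xs i).1 ^+ 2; pose sx2 := \sum_(i < n) (xs i).2 ^+ 2.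
pose sy1 := \sum_(j < m) (ys j).1 ^+ 2.
pose epsN := h * tmin * e / 2 * N%:R.
have sx1E : `|sx1 - n%:R * s.1| <= epsN.
  by rewrite mulr_natl; move: hx1; rewrite sumrB sumr_const card_ord.
have sx2E : `|sx2 - n%:R * s.2| <= epsN.
  by rewrite mulr_natl; move: hx2; rewrite sumrB sumr_const card_ord.
have sy1E : `|sy1 - m%:R * s.1| <= epsN.
  by rewrite mulr_natl; move: hy1; rewrite sumrB sumr_const card_ord.
have CE : C = sx1 + sy1.
  rewrite /C /resid1; congr (_ + _); apply: eq_bigr => i _; ring.
have DE : D = sx2.
  rewrite /D /resid2; apply: eq_bigr => i _; ring.
have eps1 : 2 * epsN <= N%:R * s.1 * e.
  rewrite (_ : 2 * epsN = h * (N%:R * tmin * e)); last by rewrite /epsN; field.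
  rewrite (le_trans (_ : _ <= 1 * (N%:R * tmin * e)))//.
    by rewrite ler_wpM2r// mulr_ge0 ?(ltW e0)// mulr_ge0// ltW.
  by rewrite mul1r ler_pM2r// ler_pM2l.
have eps2 : epsN <= n%:R * s.2 * e.
  rewrite (_ : epsN = h * N%:R * tmin * e / 2); last by rewrite /epsN; field.
  have hNt : h * N%:R * tmin <= n%:R * s.2.
    by rewrite ler_pM// ?(ltW tmin0)// mulr_ge0// ltW.
  have : h * N%:R * tmin * e <= n%:R * s.2 * e by rewrite ler_wpM2r// ltW.
  have : 0 <= h * N%:R * tmin * e by exact/ltW/(mulr_gt0 _ e0)/(mulr_gt0 _ tmin0)/mulr_gt0.
  clear; lra.
have epsh : epsN <= h * tmin / 2 * N%:R.
  by rewrite /epsN ler_wpM2r// ler_pM2r// ler_piMr ?(ltW ht0)// (le_trans ee1)// (le_trans e1dl)// ltW.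
have hC : `|C - N%:R * s.1| <= N%:R * s.1 * e.
  rewrite CE (_ : _ - _ = (sx1 - n%:R * s.1) + (sy1 - m%:R * s.1)); last by rewrite mE; ring.
  by rewrite (le_trans (ler_normD _ _))// (le_trans (lerD sx1E sy1E))//; move: eps1; clear; lra.
have hD : `|D - n%:R * s.2| <= n%:R * s.2 * e by rewrite DE (le_trans sx2E).
have wide (X S e' : R) : 0 < S -> e <= e' -> `|X - S| <= S * e ->
    S * (1 - e') <= X <= S * (1 + e').
  move=> S0 ee'; have Se : S * e <= S * e' by rewrite ler_wpM2l// ltW.
  by rewrite ler_norml => /andP[]; move: Se; clear => *; apply/andP; split; lra.
have n0 : 0 < n%:R :> R by apply: lt_le_trans hNn; rewrite mulr_gt0.
have Ns1 : 0 < N%:R * s.1 by rewrite mulr_gt0.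
have ns2 : 0 < n%:R * s.2 by rewrite mulr_gt0.
pose a := h * tmin / 2 * N%:R.
have a_gt0 : 0 < a by rewrite mulr_gt0// divr_gt0.
pose k := 8 * kap ^+ 2 / (h * tmin).
have hA (X S : R) : tmin <= S -> `|X - n%:R * S| <= epsN -> a <= X.
  move=> tS; rewrite ler_norml => /andP[Xl _].
  have : h * N%:R * tmin <= n%:R * S by rewrite ler_pM// ?(ltW tmin0)// mulr_ge0// ltW.
  by move: Xl epsh; rewrite /a; clear; lra.
have A2 : a <= sx1 by exact: (hA _ _ tmin1 sx1E).
have A1 : a <= sx2 + m%:R * y ^+ 2.
  by rewrite -[leLHS]addr0 lerD ?(hA _ _ tmin2 sx2E)// mulr_ge0// sqr_ge0.
pose B2 := \sum_(i < n) (xs i).1 * (xs i).2.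
pose B1 := B2 + \sum_(j < m) y * (ys j).1.
have ka : k * a = (2 * (kap * Num.sqrt N%:R)) ^+ 2.
  by rewrite !exprMn sqr_sqrtr ?ltW// /k /a; field; rewrite !gt_eqF.
have B2k : B2 ^+ 2 <= k * a.
  rewrite ka sqr_le_of_norm// (le_trans hxy)// ler_peMl ?ler1n//.
  exact: le_trans hxy.
have B1k : B1 ^+ 2 <= k * a.
  rewrite ka sqr_le_of_norm// (le_trans (ler_normD _ _))// mulr_natl mulr2n.
  exact: lerD.
have a0N : a0 * N%:R = a / 2 by rewrite /a0 /a; field.
have k0E : k0 = 2 * k by rewrite /k0 /k; field; rewrite !gt_eqF.
have mr1 : measurable_fun setT (resid1 y xs ys).
  by apply: (@measurable_resid1 R _ _ _ y n m (fun i _ => xs i) (fun j _ => ys j) id).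
have mr2 : measurable_fun setT (resid2 xs).
  by apply: (@measurable_resid2 R _ _ _ n (fun i _ => xs i) id).
have ev1E : evidence pi y xs ys S1 = (\int[@leb3 R]_(th in @Theta R)
    (cst * gauss_lik N n (resid1 y xs ys th.1) D th.2 * prior1 pi th)%:E)%E.
  by apply: eq_integral => -[w t]; rewrite inE => vt; rewrite likelihoodE.
have ev2E : evidence pi y xs ys S2 = (\int[@leb3 R]_(th in @Theta R)
    (cst * gauss_lik N n C (resid2 xs th.1) th.2 * prior2 pi th)%:E)%E.
  by apply: eq_integral => -[w t]; rewrite inE => vt; rewrite likelihoodE.
have ev3E : evidence pi y xs ys S3 = (\int[@leb2 R]_(t in @variances R)
    (cst * gauss_lik N n C D t * prior3 pi t)%:E)%E.
  by apply: eq_integral => t; rewrite inE => vt; rewrite likelihoodE.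
have ev0 S : (0 <= evidence pi y xs ys S)%E by exact: evidence_ge0.
rewrite mulrDl; apply: posterior_error_le => //.
- rewrite ev3E; apply: (@gauss_lik_evidence_pos_fin _ s (prior3 pi s / 2) e) => //.
  + by rewrite e0/= (le_trans ee1)// (le_trans e1dl).
  + move=> t ct; apply: cp3; apply: sub_corner_box ct => //; first exact: ltW.
    exact: le_trans e1dl.
  + exact: wide hC.
  + exact: wide hD.
- rewrite ev1E ev3E.
  apply: (H1 N n cst C D (resid1 y xs ys) (fun=> D)) => //.
  + by rewrite (le_trans _ N0)// le_max lexx.
  + exact: wide hC.
  + exact: wide hD.
  + left => w; split => //; rewrite resid1E a0N k0E.
    have := quadratic_ge w a_gt0 A1 B1k; rewrite -/C -/sx2 -/B2 -/B1; clear; lra.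
- rewrite ev2E ev3E.
  apply: (H2 N n cst C D (fun=> C) (resid2 xs)) => //.
  + by rewrite (le_trans _ N0)// le_max lexx orbT.
  + exact: wide hC.
  + exact: wide hD.
  + right => w; split => //; rewrite resid2E a0N k0E.
    have := quadratic_ge w a_gt0 A2 B2k; rewrite -/D -/sx1 -/B2; clear; lra.
Qed.

End posterior_bound.

(** * Posterior rate under the independence model *)

Lemma obs_S3_rectangle d (T : measurableType d) (R : realType) (P : probability T R)
    (X : {RV P >-> (R * R)%type}) (t1 t2 : R) :
  (forall A : set (R * R), measurable A ->
     distribution P X A = obs_law S3 (0, (t1, t2)) A) ->
  forall A B : set R, measurable A -> measurable B ->
    P ((fun o => (X o).1) @^-1` A `&` (fun o => (X o).2) @^-1` B) =
    (normal_prob 0 (Num.sqrt t1) A * normal_prob 0 (Num.sqrt t2) B)%E.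
Proof.
move=> law A B mA mB; have mAB : measurable (A `*` B) by exact: measurableX.
transitivity (distribution P X (A `*` B)) => //.
rewrite law// /obs_law /pushforward /noise_law /=.
transitivity ((normal_prob 0 (Num.sqrt t1) \x normal_prob 0 (Num.sqrt t2))%E
  ((A : set (measurableTypeR R)) `*` (B : set (measurableTypeR R)))) => //.
by rewrite product_measure1E.
Qed.

Lemma int_S3_law d (T : measurableType d) (R : realType) (P : probability T R)
    (Y : {RV P >-> (R * R)%type}) (y t1 t2 : R) :
  (forall A : set (R * R), measurable A ->
     distribution P Y A = int_law y S3 (0, (t1, t2)) A) ->
  forall A : set R, measurable A ->
    P ((fun o => (Y o).1) @^-1` A) = normal_prob 0 (Num.sqrt t1) A.
Proof.
move=> law A mA; have mAT : measurable (A `*` [set: R]) by exact: measurableX.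
transitivity (distribution P Y (A `*` [set: R])).
  by congr (P _); apply/seteqP; split => o //= [].
rewrite law// /int_law /pushforward /=; congr (normal_prob _ _ _).
by apply/seteqP; split => u //= [].
Qed.

Lemma common_bound (R : realType) (a b c d e : R) :
  0 <= a -> 0 <= b -> 0 <= c -> 0 <= d -> 0 <= e ->
  exists v : R, [/\ 0 < v, a + c <= v, b + d <= v, a + b <= v & e <= v].
Proof. by move=> *; exists (1 + a + b + c + d + e); split; lra. Qed.

Lemma chebyshev_ratio_le (R : realType) (N v eps e : R) :
  0 < N -> 0 < v -> 0 < eps -> 0 < e -> 5 * v / (eps ^+ 2 * e) <= N ->
  N * v / (eps * N) ^+ 2 <= e / 5.
Proof.
move=> N0 v0 eps0 e0; rewrite ler_pdivrMr ?mulr_gt0 ?exprn_gt0// => h.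
have -> : N * v / (eps * N) ^+ 2 = v / (eps ^+ 2 * N) by field; rewrite !gt_eqF.
by rewrite ler_pdivrMr ?mulr_gt0 ?exprn_gt0//; lra.
Qed.

Theorem theorem4p2 (R : realType) (y : R)
    (d : measure_display) (Omega : measurableType d) (P : probability Omega R)
    (pi : priors R)
    (n m : nat -> nat) (eta : R)
    (X : forall N : nat, 'I_(n N) -> {RV P >-> (R * R)%type})
    (Y : forall N : nat, 'I_(m N) -> {RV P >-> (R * R)%type})
    (t1 t2 : R) :
  is_density (@leb3 R) (@Theta R) (prior1 pi) ->
  is_density (@leb3 R) (@Theta R) (prior2 pi) ->
  is_density (@leb2 R) (@variances R) (prior3 pi) ->
  ndifferentiable 4 (@Theta R) (prior1 pi) ->
  ndifferentiable 4 (@Theta R) (prior2 pi) ->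
  ndifferentiable 4 (@variances R) (prior3 pi) ->
  0 < t1 -> 0 < t2 ->
  0 < prior3 pi (t1, t2) ->
  (forall N, n N + m N = N)%N ->
  {homo n : N N' / (N <= N')%N} ->
  {homo m : N N' / (N <= N')%N} ->
  0 < eta < 1 ->
  (fun N => (n N)%:R / N%:R : R) @ \oo --> eta ->
  (forall N (i : 'I_(n N)) (A : set (R * R)), measurable A ->
     distribution P (X N i) A = obs_law S3 (0, (t1, t2)) A) ->
  (forall N (j : 'I_(m N)) (A : set (R * R)), measurable A ->
     distribution P (Y N j) A = int_law y S3 (0, (t1, t2)) A) ->
  (forall N, mutually_independent
     (fun k : 'I_(n N) + 'I_(m N) =>
        match k with inl i => X N i | inr j => Y N j end)) ->
  bounded_in_probability P (fun N o =>
    Num.sqrt N%:R *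
      (1 - posterior pi y (fun i => X N i o) (fun j => Y N j o) S3)).
Proof.
move=> dens1 dens2 dens3 [df1 _] [df2 _] [df3 _] t10 t20 p30 nmN _ _.
move=> /andP[eta0 eta1] cvg_eta lawX lawY indep.
have vs : variances (t1, t2) by [].
have c1 : {for (0, (t1, t2)), continuous (prior1 pi)}.
  by apply: differentiable_continuous; exact: df1.
have c2 : {for (0, (t1, t2)), continuous (prior2 pi)}.
  by apply: differentiable_continuous; exact: df2.
have c3 : {for (t1, t2), continuous (prior3 pi)}.
  by apply: differentiable_continuous; exact: df3.
have h01 : 0 < eta / 2 <= 1 by lra.
have four0 t : 0 <= normal_fourth_moment t :> R.
  by rewrite fine_ge0// integral_ge0// => x _; rewrite lee_fin exprn_even_ge0.
(* v bounds the second moments of all five summands. *)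
have [v [v0 va1 va2 va3 va4]] := common_bound (four0 t1) (four0 t2)
  (sqr_ge0 t1) (sqr_ge0 t2) (mulr_ge0 (sqr_ge0 y) (ltW t10)).
move=> e e0.
(* Chebyshev's bound on a cross term is v / kap^2, whatever N is; it has to be a
   fifth of the allowed probability. *)
pose kap := Num.sqrt (5 * v / e).
have kap2 : kap ^+ 2 = 5 * v / e.
  by rewrite sqr_sqrtr// divr_ge0 ?mulr_ge0// ltW.
have kap0 : 0 < kap by rewrite sqrtr_gt0 divr_gt0// mulr_gt0.
have [eps [K [N0 [eps0 K0 bound]]]] :=
  posterior_bound y kap dens1 dens2 dens3 c1 c2 c3 vs p30 h01.
exists K.
have mX N i : measurable_fun setT (X N i) by [].
have mY N j : measurable_fun setT (Y N j) by [].
have mX1 N i : measurable_fun setT (fun o => (X N i o).1).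
  by apply: (measurableT_comp measurable_fst).
have mX2 N i : measurable_fun setT (fun o => (X N i o).2).
  by apply: (measurableT_comp measurable_snd).
have mY1 N j : measurable_fun setT (fun o => (Y N j o).1).
  by apply: (measurableT_comp measurable_fst).
have momX N i := product_moments t10 t20 (mX1 N i) (mX2 N i) (obs_S3_rectangle (lawX N i)).
have chebX N (f : R * R -> R) (a : R) : measurable_fun setT f -> 0 < a ->
    (forall i, \int[P]_o (f (X N i o))%:E = 0)%E ->
    (forall i, \int[P]_o (f (X N i o) ^+ 2)%:E <= v%:E)%E ->
    (P [set o | (a <= `|\sum_(i < n N) f (X N i o)|)%R] <= (N%:R * v / a ^+ 2)%R%:E)%E.
  move=> mf a0 f1' f2'.
  have := @chebyshev_iid_sum _ _ _ P _ _ _ _ (n N) inl f v a (indep N).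
  move=> /(_ (fun i j => @inl_inj _ _ i j) mf f1' f2' a0)/le_trans; apply.
  rewrite lee_fin ler_wpM2r ?invr_ge0 ?sqr_ge0// ler_wpM2r ?(ltW v0)// ler_nat.
  by rewrite -[leqRHS]nmN leq_addr.
have chebY N (f : R * R -> R) (a : R) : measurable_fun setT f -> 0 < a ->
    (forall i, \int[P]_o (f (Y N i o))%:E = 0)%E ->
    (forall i, \int[P]_o (f (Y N i o) ^+ 2)%:E <= v%:E)%E ->
    (P [set o | (a <= `|\sum_(i < m N) f (Y N i o)|)%R] <= (N%:R * v / a ^+ 2)%R%:E)%E.
  move=> mf a0 f1' f2'.
  have := @chebyshev_iid_sum _ _ _ P _ _ _ _ (m N) inr f v a (indep N).
  move=> /(_ (fun i j => @inr_inj _ _ i j) mf f1' f2' a0)/le_trans; apply.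
  rewrite lee_fin ler_wpM2r ?invr_ge0 ?sqr_ge0// ler_wpM2r ?(ltW v0)// ler_nat.
  by rewrite -[leqRHS]nmN leq_addl.
near=> N.
have N_gt0 : (0 < N)%N by near: N; exact: nbhs_infty_gt.
have NR0 : 0 < N%:R :> R by rewrite ltr0n.
have N0N : N0 <= N%:R by near: N; exact: nbhs_infty_ger.
have epsN : 5 * v / (eps ^+ 2 * e) <= N%:R by near: N; exact: nbhs_infty_ger.
have nN : eta / 2 * N%:R <= (n N)%:R.
  rewrite -ler_pdivlMr//; near: N.
  by apply: (cvgr_ge _ cvg_eta); rewrite ltr_pdivrMr// ltr_pMr// ltr1n.
have ratio_eps : N%:R * v / (eps * N%:R) ^+ 2 <= e / 5 by exact: chebyshev_ratio_le.
have ratio_kap : N%:R * v / (kap * Num.sqrt N%:R) ^+ 2 <= e / 5.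
  rewrite exprMn kap2 sqr_sqrtr// le_eqVlt; apply/orP; left; apply/eqP.
  by field; rewrite !gt_eqF.
pose B1 := [set o | eps * N%:R <= `|\sum_(i < n N) ((X N i o).1 ^+ 2 - t1)|].
pose B2 := [set o | eps * N%:R <= `|\sum_(i < n N) ((X N i o).2 ^+ 2 - t2)|].
pose B3 := [set o | eps * N%:R <= `|\sum_(j < m N) ((Y N j o).1 ^+ 2 - t1)|].
pose B4 := [set o | kap * Num.sqrt N%:R <= `|\sum_(i < n N) ((X N i o).1 * (X N i o).2)|].
pose B5 := [set o | kap * Num.sqrt N%:R <= `|\sum_(j < m N) (y * (Y N j o).1)|].
have epsN0 : 0 < eps * N%:R by rewrite mulr_gt0.
have kapN0 : 0 < kap * Num.sqrt N%:R by rewrite mulr_gt0// sqrtr_gt0.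
have mset (a : R) k (f : 'I_k -> Omega -> R) : (forall i, measurable_fun setT (f i)) ->
    measurable [set o | a <= `|\sum_(i < k) f i o|].
  move=> mf; have mS : measurable_fun setT (fun o => `|\sum_(i < k) f i o|).
    by apply: measurableT_comp => //; exact: measurable_sum.
  rewrite (_ : [set o | _] = setT `&` (fun o => `|\sum_(i < k) f i o|) @^-1` `[a, +oo[).
    exact: mS.
  by rewrite setTI; apply/seteqP; split => o /=; rewrite in_itv/= andbT.
have msq (g : Omega -> R) t : measurable_fun setT g -> measurable_fun setT (fun o => g o ^+ 2 - t).
  by move=> mg; apply: measurable_funB => //; exact: measurable_funX.
have m1 : measurable_fun setT (fun x : R * R => x.1) by exact: measurable_fst.
have m2 : measurable_fun setT (fun x : R * R => x.2) by exact: measurable_snd.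
have PB1 : (P B1 <= (e / 5)%:E)%E.
  apply: (@le_trans _ _ (N%:R * v / (eps * N%:R) ^+ 2)%:E); last by rewrite lee_fin.
  apply: (chebX N (fun x => x.1 ^+ 2 - t1)) => //.
  - by apply: measurable_funB => //; exact: measurable_funX.
  - by move=> i; have [l1 _ _ _] := momX N i; case: (centered_square_moments t10 (mX1 N i) l1).
  - move=> i; have [l1 _ _ _] := momX N i.
    by case: (centered_square_moments t10 (mX1 N i) l1) => _ /le_trans; apply; rewrite lee_fin.
have PB2 : (P B2 <= (e / 5)%:E)%E.
  apply: (@le_trans _ _ (N%:R * v / (eps * N%:R) ^+ 2)%:E); last by rewrite lee_fin.
  apply: (chebX N (fun x => x.2 ^+ 2 - t2)) => //.
  - by apply: measurable_funB => //; exact: measurable_funX.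
  - by move=> i; have [_ l2 _ _] := momX N i; case: (centered_square_moments t20 (mX2 N i) l2).
  - move=> i; have [_ l2 _ _] := momX N i.
    by case: (centered_square_moments t20 (mX2 N i) l2) => _ /le_trans; apply; rewrite lee_fin.
have PB3 : (P B3 <= (e / 5)%:E)%E.
  apply: (@le_trans _ _ (N%:R * v / (eps * N%:R) ^+ 2)%:E); last by rewrite lee_fin.
  apply: (chebY N (fun x => x.1 ^+ 2 - t1)) => //.
  - by apply: measurable_funB => //; exact: measurable_funX.
  - by move=> i; case: (centered_square_moments t10 (mY1 N i) (int_S3_law (lawY N i))).
  - move=> i; case: (centered_square_moments t10 (mY1 N i) (int_S3_law (lawY N i))) => _.
    by move=> /le_trans; apply; rewrite lee_fin.
have PB4 : (P B4 <= (e / 5)%:E)%E.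
  apply: (@le_trans _ _ (N%:R * v / (kap * Num.sqrt N%:R) ^+ 2)%:E); last by rewrite lee_fin.
  apply: (chebX N (fun x => x.1 * x.2)) => //.
  - exact: measurable_funM.
  - by move=> i; have [_ _ E1 _] := momX N i.
  - by move=> i; have [_ _ _ /le_trans] := momX N i; apply; rewrite lee_fin.
have PB5 : (P B5 <= (e / 5)%:E)%E.
  apply: (@le_trans _ _ (N%:R * v / (kap * Num.sqrt N%:R) ^+ 2)%:E); last by rewrite lee_fin.
  have st0 : 0 < Num.sqrt t1 by rewrite sqrtr_gt0.
  apply: (chebY N (fun x => y * x.1)) => //.
  - exact: measurable_funM.
  - move=> j; have [E1 E2 _] := normal_rv_moments st0 (mY1 N j) (int_S3_law (lawY N j)).
    under eq_integral do rewrite EFinM.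
    rewrite integralZl// ?E1 ?mule0//; apply: integrable_of_sqr => //.
    by rewrite E2 ltry.
  - move=> j; have [_ E2 _] := normal_rv_moments st0 (mY1 N j) (int_S3_law (lawY N j)).
    under eq_integral do rewrite exprMn EFinM.
    have mE : measurable_fun setT (fun o => ((Y N j o).1 ^+ 2)%:E).
      by apply/measurable_EFinP; exact: measurable_funX.
    have pE (o : Omega) : setT o -> (0 <= ((Y N j o).1 ^+ 2)%:E)%E.
      by rewrite lee_fin sqr_ge0.
    rewrite (ge0_integralZl_EFin P measurableT pE mE (sqr_ge0 y)).
    by rewrite E2 sqr_sqrtr ?(ltW t10)// -EFinM lee_fin.
have mB1 : measurable B1 by apply: mset => i; exact: msq.
have mB2 : measurable B2 by apply: mset => i; exact: msq.
have mB3 : measurable B3 by apply: mset => i; exact: msq.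
have mB4 : measurable B4 by apply: mset => i; exact: measurable_funM.
have mB5 : measurable B5 by apply: mset => i; exact: measurable_funM.
apply: (@le_trans _ _ (P (B1 `|` (B2 `|` (B3 `|` (B4 `|` B5)))))).
  apply: le_measure; rewrite ?inE.
  - have mZ : measurable_fun setT (fun o => `|Num.sqrt N%:R *
        (1 - posterior pi y (fun i => X N i o) (fun j => Y N j o) S3)|).
      apply: measurableT_comp => //; apply: measurable_funM => //.
      apply: measurable_funB => //.
      exact: (@measurable_posterior _ Omega R y (n N) (m N) (fun i o => X N i o) (fun j o => Y N j o) pi).
    rewrite (_ : [set o | _] = setT `&` (fun o => `|Num.sqrt N%:R *
        (1 - posterior pi y (fun i => X N i o) (fun j => Y N j o) S3)|) @^-1` `]K, +oo[).
      exact: mZ.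
    by rewrite setTI; apply/seteqP; split => o /=; rewrite in_itv/= andbT.
  - by do 4 (apply: measurableU => //).
  move=> o /=; apply: contraPP => /not_orP[/negP nB1 /not_orP[/negP nB2 /not_orP[/negP nB3 /not_orP[/negP nB4 /negP nB5]]]].
  have := bound (n N) (m N) (fun i => X N i o) (fun j => Y N j o).
  rewrite nmN => /(_ N0N N_gt0 nN).
  move: nB1 nB2 nB3 nB4 nB5; rewrite -!ltNge => /ltW nB1 /ltW nB2 /ltW nB3 /ltW nB4 /ltW nB5.
  move=> /(_ nB1 nB2 nB3 nB4 nB5) H.
  apply/negP; rewrite -leNgt normrM ger0_norm ?sqrtr_ge0//.
  by rewrite mulrC -ler_pdivlMr// sqrtr_gt0.
have U2 (A B : set Omega) (x : R) : measurable A -> measurable B ->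
    (P A <= (e / 5)%:E)%E -> (P B <= x%:E)%E -> (P (A `|` B) <= (e / 5 + x)%:E)%E.
  by move=> mA mB PA PB; rewrite (le_trans (measureU2 _ mA mB))// EFinD leeD.
rewrite [leRHS](_ : _ = (e / 5 + (e / 5 + (e / 5 + (e / 5 + e / 5))))%:E); last first.
  by congr EFin; field.
have m45 := measurableU _ _ mB4 mB5; have m345 := measurableU _ _ mB3 m45.
have m2345 := measurableU _ _ mB2 m345.
exact: (U2 _ _ _ mB1 m2345 PB1 (U2 _ _ _ mB2 m345 PB2
  (U2 _ _ _ mB3 m45 PB3 (U2 _ _ _ mB4 mB5 PB4 PB5)))).
Unshelve. all: by end_near. Qed.
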